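(* Assume the two-layer linear setting below together with Assumptions (A1) and (A2), that $\lambda_1=c_1 n$ for a constant $c_1>0$ with $\eta c_1<1$, and that $\lambda_r>0$. Then for every $\epsilon>0$ there exist constants $C_1,C_2,C_3>0$, depending only on $\chi$, $c_1$ and $\eta c_1$, such that the following holds. Suppose $$m\ge C_1\frac{n^2}{\lambda_r^2}\quad\text{and}\quad n\ge C_2\max\Big\{\frac{\lambda_r}{\kappa^2},\frac{\lambda_r^2}{\kappa^2},\frac{\lambda_r^2}{\kappa^4\epsilon^2},\frac{\lambda_r^4}{\kappa^4\epsilon^2}\Big\}.$$ Let $t_0$ be the first iteration at which either $\|D(t)\|^2\le C_3\epsilon^2$ or $\lambda_{\max}(M^*(t))>1/\eta$. Then for all $t=1,2,\dots,t_0-1$: (i) $\Lambda^*(t+1)-\Lambda^*(t)>0$; and (ii) $\|\Gamma(t)\|\le 40/m$.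
   Context: Two-layer linear setting. Let $m$ be even and let $d,n\ge1$. The data matrix is $X=[x_1,\dots,x_n]\in\mathbb R^{d\times n}$ and the labels are $Y=(y_1,\dots,y_n)^\top\in\{-1,1\}^n$, so that $\|Y\|=\sqrt n$. Assume there exist $A^*\in\mathbb R^m$ and $W^*\in\mathbb R^{m\times d}$ with $Y^\top=A^{*\top}W^*X$. The network is $f(x)=\frac1{\sqrt m}A^\top Wx$ with $A\in\mathbb R^m$ and $W\in\mathbb R^{m\times d}$, whose rows are denoted $w_q^\top$. Define the output vector $F=\frac1{\sqrt m}X^\top W^\top A\in\mathbb R^n$, the residual $D=F-Y$, and the loss $\mathcal L=\frac1n\|D\|^2$. Gradient descent with step size $\eta>0$ is $$A(t+1)=A(t)-\tfrac{2\eta}{n\sqrt m}W(t)XD(t),\qquad W(t+1)=W(t)-\tfrac{2\eta}{n\sqrt m}A(t)D(t)^\top X^\top.$$ The initialization is symmetric: $a_q(0)\in\{-1,1\}$ and $a_{q+m/2}(0)=-a_q(0)$, $w_{q+m/2}(0)=w_q(0)$ for $q\le m/2$, and $\sum_{q\le m/2}w_q(0)w_q(0)^\top=\frac{m}{2d}I_d$. Consequently $F(0)=0$, $\|A(0)\|^2=m$ and $W(0)^\top W(0)=\frac md I_d$. Define the following matrices: - the Gram matrix $M(t)=\frac{2}{mn}\big(\|A(t)\|^2X^\top X+X^\top W(t)^\top W(t)X\big)$; - $M^*(t)=M(t)-\frac{4\eta}{n^2m}(D(t)^\top F(t))X^\top X$; - $\Gamma(t)=\frac{2}{mn}\big(X^\top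 W(t)^\top W(t)X-\frac md X^\top X\big)$; - $\tilde M(t)=M^*(t)-\Gamma(t)$, which equals $\frac{2}{mn}\big(\|A(t)\|^2+\frac md-\frac{2\eta}{n}D(t)^\top F(t)\big)X^\top X$. $X^\top X$ has rank $r$ and eigendecomposition $\sum_{i=1}^r\lambda_iv_iv_i^\top$, with orthonormal $v_i$ and $\lambda_1\ge\dots\ge\lambda_r>0$. Set $z_i=Y^\top v_i$. For a matrix of the form $\gamma X^\top X$, write $\lambda_i(\cdot):=v_i^\top(\cdot)v_i=\gamma\lambda_i$. Define $\Lambda^*(t)=v_1^\top M(t)v_1$. All norms are Euclidean or spectral. (A1): there is a constant $\chi>1$ with $\lambda_i\le\chi\lambda_{i+1}$ for all $i\in[r-1]$, and moreover $\lambda_1\ge2\lambda_2$. (A2): there is $\kappa>0$ with $z_i/\sqrt n\ge\kappa$ for all $i\in[r]$. *)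

(* Defs.v *)
From HB Require Import structures.
From mathcomp Require Import all_boot all_order all_algebra.
From mathcomp Require Import classical_sets reals.
Set Implicit Arguments.
Unset Strict Implicit.
Unset Printing Implicit Defensive.
Import Order.TTheory GRing.Theory Num.Theory.
Local Open Scope ring_scope.

Section TwoLayer.
Variable R : realType.

Definition sqnorm k (v : 'cV[R]_k) : R := \sum_(i < k) (v i 0) ^+ 2.
Definition enorm k (v : 'cV[R]_k) : R := Num.sqrt (sqnorm v).

Definition opnorm p q (G : 'M[R]_(p, q)) : R :=
  sup [set enorm (G *m u) | u in [set u : 'cV[R]_q | enorm u <= 1]].

Definition sc (a : 'M[R]_1) : R := a 0 0.

Variables (d n m : nat) (eta : R) (X : 'M[R]_(d, n)) (Y : 'cV[R]_n).

Definition outF (A : 'cV[R]_m) (W : 'M[R]_(m, d)) : 'cV[R]_n :=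
  (Num.sqrt (m%:R))^-1 *: (X^T *m W^T *m A).

Definition resD (A : 'cV[R]_m) (W : 'M[R]_(m, d)) : 'cV[R]_n :=
  outF A W - Y.

Definition gd_step (AW : 'cV[R]_m * 'M[R]_(m, d)) : 'cV[R]_m * 'M[R]_(m, d) :=
  let A := AW.1 in let W := AW.2 in
  let D := resD A W in
  let s := 2 * eta / (n%:R * Num.sqrt (m%:R)) in
  (A - s *: (W *m X *m D), W - s *: (A *m D^T *m X^T)).

Definition traj (A0 : 'cV[R]_m) (W0 : 'M[R]_(m, d)) (t : nat) :=
  iter t gd_step (A0, W0).

Section AtTime.
Variables (A0 : 'cV[R]_m) (W0 : 'M[R]_(m, d)).
Definition At t := (traj A0 W0 t).1.
Definition Wt t := (traj A0 W0 t).2.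
Definition Ft t := outF (At t) (Wt t).
Definition Dt t := resD (At t) (Wt t).

Definition Mt t : 'M[R]_n :=
  (2 / (m%:R * n%:R)) *:
    (sqnorm (At t) *: (X^T *m X) + X^T *m (Wt t)^T *m Wt t *m X).

Definition Mstar t : 'M[R]_n :=
  Mt t - (4 * eta / (n%:R ^+ 2 * m%:R) * sc ((Dt t)^T *m Ft t)) *: (X^T *m X).

Definition Gammat t : 'M[R]_n :=
  (2 / (m%:R * n%:R)) *:
    (X^T *m (Wt t)^T *m Wt t *m X - (m%:R / d%:R) *: (X^T *m X)).
End AtTime.

End TwoLayer.

(* Main.v *)
Require Import Defs.
From HB Require Import structures.
From mathcomp Require Import all_boot all_order all_algebra.
From mathcomp Require Import boolp classical_sets reals.
From mathcomp Require Import ring lra.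
Import Order.TTheory GRing.Theory Num.Theory.
Local Open Scope ring_scope.

(* With D(t+1) = (1 - eta M^*(t)) D(t) and M^*(t) = gain(t) X^T X + Gamma(t),
   the eigen-coordinates x_i = - v_i^T D start at z_i and contract by factors
   1 - eta gain(t) lambda_i, up to a noise coming from Gamma.  Everything is one
   induction on t.  Summing eta lambda_i |x_i| / n over time telescopes to at
   most z_i plus the accumulated noise, and increments of Gamma_ij are products
   of such a term with |z_j - x_j| or |x_j|; hence |Gamma_ij| is dominated by a
   rank-one matrix b_i b_j with |b|^2 of order n, so |Gamma| <= 36/m.  In turn
   the noise is at most 72 eta |x| / m while |x| decays at least at rate
   eta lambda_r / (2 n), so the total noise also telescopes and is of order
   n^(3/2) / (m lambda_r), which the width condition makes small.

   The sharpness increment is bounded below by a multiple of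
   sum_i w_i (z_i - x_i) x_i with weights w_i in {1, 2}.  Without noise each
   summand is z_i^2 p_i (1 - p_i), where p_i is the product of the contraction
   factors.  If some p_i >= 1/2, the first such i has 1 - p_i bounded below: its
   predecessor has p < 1/2 and lambda_i is within a factor chi of lambda_{i-1}.
   Otherwise the sum is at least kappa sqrt(n) |x| / 2, and |x| > 2 eps before
   stopping.  Both beat the noise. *)

(** * Euclidean norms and Rayleigh quotients *)

Section EuclideanNorm.
Variables (R : realType) (k : nat).
Implicit Types a b : 'I_k -> R.

Definition nrm a : R := Num.sqrt (\sum_i a i ^+ 2).

Lemma nrm_ge0 a : 0 <= nrm a.
Proof. exact: sqrtr_ge0. Qed.

Lemma nrm_sqr a : nrm a ^+ 2 = \sum_i a i ^+ 2.
Proof. by rewrite sqr_sqrtr// sumr_ge0// => i _; exact: sqr_ge0. Qed.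

Lemma eq_nrm a b : a =1 b -> nrm a = nrm b.
Proof. by move=> ab; congr Num.sqrt; apply: eq_bigr => i _; rewrite ab. Qed.

Lemma nrm_le a (c : R) : 0 <= c -> \sum_i a i ^+ 2 <= c ^+ 2 -> nrm a <= c.
Proof. by move=> c0; rewrite -nrm_sqr ler_sqr ?nnegrE// nrm_ge0. Qed.

Lemma ler_nrm a b : (forall i, `|a i| <= b i) -> nrm a <= nrm b.
Proof.
move=> ab; apply: nrm_le; first exact: nrm_ge0.
rewrite nrm_sqr; apply: ler_sum => i _.
by rewrite -real_normK ?num_real// lerXn2r ?nnegrE// (le_trans _ (ab i)).
Qed.

(** Expand the nonnegative sum of the squares of [nrm b ^+ 2 * a i - s * b i], with [s] the inner
    product; the case [nrm b = 0] is treated apart. *)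
Lemma cauchy_schwarz a b : \sum_i a i * b i <= nrm a * nrm b.
Proof.
have [s sE] : exists s, \sum_i a i * b i = s by exists (\sum_i a i * b i).
rewrite sE.
have [b0|b0] := eqVneq (nrm b) 0.
  have bi0 i : b i = 0.
    have /eqP : \sum_i b i ^+ 2 = 0 by rewrite -nrm_sqr b0 expr0n.
    rewrite psumr_eq0; last by move=> j _; exact: sqr_ge0.
    by move=> /allP/(_ i (mem_index_enum _)); rewrite sqrf_eq0 => /eqP.
  by rewrite b0 mulr0 -sE big1// => i _; rewrite bi0 mulr0.
have bp : 0 < nrm b by rewrite lt_def b0 nrm_ge0.
have : 0 <= \sum_i (nrm b ^+ 2 * a i - s * b i) ^+ 2.
  by apply: sumr_ge0 => i _; exact: sqr_ge0.
have -> : \sum_i (nrm b ^+ 2 * a i - s * b i) ^+ 2 =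
    nrm b ^+ 4 * nrm a ^+ 2 - 2 * nrm b ^+ 2 * s * s + s ^+ 2 * nrm b ^+ 2.
  transitivity (nrm b ^+ 4 * \sum_i a i ^+ 2
    - 2 * nrm b ^+ 2 * s * \sum_i a i * b i + s ^+ 2 * \sum_i b i ^+ 2).
    rewrite !mulr_sumr -sumrB -big_split/=; apply: eq_bigr => i _; ring.
  by rewrite -!nrm_sqr sE.
have -> : nrm b ^+ 4 * nrm a ^+ 2 - 2 * nrm b ^+ 2 * s * s + s ^+ 2 * nrm b ^+ 2
  = nrm b ^+ 2 * ((nrm a * nrm b) ^+ 2 - s ^+ 2) by ring.
rewrite pmulr_rge0 ?exprn_gt0// subr_ge0 => h.
apply: (le_trans (ler_norm s)).
rewrite -ler_sqr ?nnegrE ?mulr_ge0 ?nrm_ge0//.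
by rewrite real_normK ?num_real.
Qed.

Lemma nrmD a b : nrm (fun i => a i + b i) <= nrm a + nrm b.
Proof.
apply: nrm_le; first by rewrite addr_ge0 ?nrm_ge0.
rewrite sqrrD !nrm_sqr (eq_bigr (fun i => a i ^+ 2 + 2 * (a i * b i) + b i ^+ 2)).
  rewrite !big_split/= lerD2r lerD2l -mulr_sumr -[leRHS]mulr_natl.
  by rewrite ler_wpM2l// cauchy_schwarz.
by move=> i _; rewrite sqrrD mulr_natl.
Qed.

Lemma nrmZ (c : R) a : nrm (fun i => c * a i) = `|c| * nrm a.
Proof.
rewrite /nrm (eq_bigr (fun i => c ^+ 2 * a i ^+ 2)); last first.
  by move=> i _; rewrite exprMn.
by rewrite -mulr_sumr sqrtrM ?sqr_ge0// sqrtr_sqr.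
Qed.

Lemma nrm_le_sum a : (forall i, 0 <= a i) -> nrm a <= \sum_i a i.
Proof.
move=> a0; apply: nrm_le; first exact: sumr_ge0.
rewrite expr2 mulr_suml; apply: ler_sum => i _.
rewrite expr2 ler_wpM2l// (bigD1 i)//= lerDl.
exact: sumr_ge0.
Qed.

Lemma le_nrm a i : `|a i| <= nrm a.
Proof.
rewrite -sqrtr_sqr ler_wsqrtr// (bigD1 i)//= lerDl.
by apply: sumr_ge0 => j _; exact: sqr_ge0.
Qed.

(** Row [i] is at most [c * b i] times the inner product of [b] with the absolute values of [a],
    which Cauchy-Schwarz bounds by [nrm b * nrm a]. This turns entrywise bounds on Gamma into a
    spectral bound. *)
Lemma nrm_rank1_dominated (c : R) (G : 'I_k -> 'I_k -> R) a b :
  0 <= c -> (forall i, 0 <= b i) -> (forall i j, `|G i j| <= c * (b i * b j)) ->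
  nrm (fun i => \sum_j G i j * a j) <= c * nrm b ^+ 2 * nrm a.
Proof.
move=> c0 b0 hG.
have absa : nrm (fun i => `|a i|) = nrm a.
  congr Num.sqrt; apply: eq_bigr => i _.
  by rewrite real_normK ?num_real.
set s := \sum_j b j * `|a j|.
have s0 : 0 <= s by apply: sumr_ge0 => j _; rewrite mulr_ge0.
apply: (@le_trans _ _ (nrm (fun i => (c * s) * b i))).
  apply: ler_nrm => i; apply: (le_trans (ler_norm_sum _ _ _)).
  have -> : c * s * b i = \sum_j c * (b i * b j) * `|a j|.
    by rewrite /s mulr_sumr mulr_suml; apply: eq_bigr => j _; ring.
  by apply: ler_sum => j _; rewrite normrM ler_wpM2r.
rewrite nrmZ ger0_norm ?mulr_ge0//.
have := cauchy_schwarz b (fun i => `|a i|); rewrite absa -/s => h.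
have -> : c * nrm b ^+ 2 * nrm a = c * (nrm b * nrm a) * nrm b by ring.
by rewrite ler_wpM2r ?nrm_ge0// ler_wpM2l.
Qed.

End EuclideanNorm.
Arguments nrm {R k} a.

(** * Quadratic forms of symmetric matrices and their eigenvalues *)

Section Rayleigh.
Variables (R : realType) (n : nat).
Implicit Types (S P : 'M[R]_n) (u w : 'cV[R]_n).

Definition qform S u w : R := sc (u^T *m S *m w).

Lemma qformE S u w : qform S u w = \sum_i \sum_j S i j * (u i 0 * w j 0).
Proof.
rewrite /qform /sc mxE exchange_big/=; apply: eq_bigr => j _.
rewrite mxE mulr_suml; apply: eq_bigr => i _; rewrite mxE; ring.
Qed.

Lemma qform_bounded S :
  exists2 C : R, 0 < C & forall u, `|qform S u u| <= C * sqnorm u.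
Proof.
exists (1 + \sum_i \sum_j `|S i j|).
  by rewrite ltr_pwDl// sumr_ge0// => i _; exact: sumr_ge0.
move=> u; rewrite qformE; apply: (le_trans (ler_norm_sum _ _ _)).
apply: (@le_trans _ _ ((\sum_i \sum_j `|S i j|) * sqnorm u)); last first.
  rewrite ler_wpM2r ?lerDr//; apply: sumr_ge0 => i _; exact: sqr_ge0.
rewrite mulr_suml; apply: ler_sum => i _; rewrite mulr_suml.
apply: (le_trans (ler_norm_sum _ _ _)); apply: ler_sum => j _.
rewrite normrM ler_wpM2l// normrM.
have nu l : `|u l 0| <= nrm (u^~ 0) by exact: (le_nrm _ _ (u^~ 0)).
have -> : sqnorm u = nrm (u^~ 0) * nrm (u^~ 0) by rewrite -expr2 nrm_sqr.
by rewrite ler_pM.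
Qed.

Lemma qform_shift S x u : qform (x%:M - S) u u = x * sqnorm u - qform S u u.
Proof.
rewrite /qform /sc mulmxBr mulmxBl mxE [X in _ + X]mxE; congr (_ - _).
rewrite mul_mx_scalar -scalemxAl mxE; congr (_ * _).
by rewrite mxE; apply: eq_bigr => i _; rewrite mxE expr2.
Qed.

Lemma qformDl S u1 u2 w : qform S (u1 + u2) w = qform S u1 w + qform S u2 w.
Proof. by rewrite /qform /sc linearD/= !mulmxDl mxE. Qed.

Lemma qformDr S u w1 w2 : qform S u (w1 + w2) = qform S u w1 + qform S u w2.
Proof. by rewrite /qform /sc mulmxDr mxE. Qed.

Lemma qformZl S c u w : qform S (c *: u) w = c * qform S u w.
Proof. by rewrite /qform /sc linearZ/= -!scalemxAl mxE. Qed.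

Lemma qformZr S c u w : qform S u (c *: w) = c * qform S u w.
Proof. by rewrite /qform /sc -scalemxAr mxE. Qed.

Lemma qformC S u w : S^T = S -> qform S u w = qform S w u.
Proof.
move=> symS; rewrite /qform /sc.
have <- : (w^T *m S *m u)^T = u^T *m S *m w.
  by rewrite !trmx_mul symS trmxK mulmxA.
by rewrite mxE.
Qed.

(** An upper bound [C] on the quadratic form of the inverse of [P] becomes the lower bound [C^-1]
    for [P], without any diagonalisation. *)
Lemma psd_unit_coercive P : P^T = P -> P \in unitmx ->
  (forall u, 0 <= qform P u u) ->
  exists2 c : R, 0 < c & forall u, c * sqnorm u <= qform P u u.
Proof.
move=> symP unitP psdP.
have [C C0 hC] := qform_bounded (invmx P).
exists C^-1 => [|u]; first by rewrite invr_gt0.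
set w := invmx P *m u.
have Pw : P *m w = u by rewrite /w mulKVmx.
have uw : qform P u w = sqnorm u.
  by rewrite /qform -mulmxA Pw /sc mxE; apply: eq_bigr => i _; rewrite mxE expr2.
have ww : qform P w w = qform (invmx P) u u.
  by rewrite /qform -[w^T *m P *m w]mulmxA Pw /w trmx_mul trmx_inv symP.
(* Positivity at [u - C^-1 P^-1 u] already gives [|u|^2 / C <= u^T P u]. *)
have := psdP (u + (- C^-1) *: w).
rewrite qformDl !qformDr !qformZl !qformZr (qformC _ w u symP) uw ww.
have /(le_trans (ler_norm _)) := hC u.
set a := qform P u u; set s := sqnorm u; set b := qform _ _ _ => bs.
have : C^-1 * (C^-1 * b) <= C^-1 * s.
  apply: ler_wpM2l; first by rewrite invr_ge0 ltW.
  by rewrite ler_pdivrMl.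
lra.
Qed.

(* [sup E] below is the least [x] with [x I - S] positive semidefinite.  If it
   exceeded [mu], then [sup E - S] would be invertible, hence coercive, and the
   level [sup E] could be lowered. *)
Lemma rayleigh_le_eigenvalue_bound S mu : S^T = S ->
  (forall a, eigenvalue S a -> a <= mu) ->
  forall u, qform S u u <= mu * sqnorm u.
Proof.
move=> symS hmu.
pose psd x := forall u, 0 <= qform (x%:M - S) u u.
have psd_mono x y : x <= y -> psd x -> psd y.
  move=> xy hx u; apply: (le_trans (hx u)); rewrite !qform_shift lerD2r.
  by rewrite ler_wpM2r// sumr_ge0// => i _; exact: sqr_ge0.
suff: psd mu by move=> h u; have := h u; rewrite qform_shift subr_ge0.
apply: contrapT => nmu.
pose E := [set x : R | ~ psd x]%classic.
have [C C0 hC] := qform_bounded S.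
have psdC : psd C.
  by move=> u; rewrite qform_shift subr_ge0 (le_trans (ler_norm _)).
have ubE (y : R) : psd y -> ubound E y.
  by move=> hy x nx; rewrite leNgt; apply/negP => /ltW/psd_mono/(_ hy).
have supE : has_sup E by split; [exists mu|exists C; exact: ubE].
set x0 := sup E.
have psd_gt x : x0 < x -> psd x.
  move=> x0x; apply: contrapT => nx.
  by have := sup_upper_bound supE nx; rewrite leNgt x0x.
have psd0 : psd x0.
  move=> u; rewrite qform_shift subr_ge0.
  set s := sqnorm u.
  have s0 : 0 <= s by rewrite sumr_ge0// => i _; exact: sqr_ge0.
  (* Levels above [x0] are admissible; raising [x0] by [e / (s + 1)] costs at most [e], and the
     [+ 1] guards against [s = 0]. *)
  apply/ler_addgt0Pr => e e0.
  have d0 : 0 < e / (s + 1) by rewrite divr_gt0// ltr_wpDl.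
  have := psd_gt (x0 + e / (s + 1)); rewrite ltrDl => /(_ d0 u).
  rewrite qform_shift subr_ge0 -/s => h; apply: (le_trans h).
  rewrite mulrDl lerD2l mulrAC ler_pdivrMr ?ltr_wpDl//.
  by rewrite ler_pM2l// lerDl.
have mux0 : mu < x0.
  by rewrite ltNge; apply/negP => /psd_mono/(_ psd0).
have unit0 : x0%:M - S \in unitmx.
  have : ~~ eigenvalue S x0 by apply/negP => /hmu; rewrite leNgt mux0.
  rewrite /eigenvalue negbK kermx_eq0 row_free_unit -opprB -scaleN1r.
  by rewrite unitmxZ ?unitrN1.
have sym0 : (x0%:M - S)^T = x0%:M - S by rewrite linearB/= tr_scalar_mx symS.
have [c c0 hc] := psd_unit_coercive _ sym0 unit0 psd0.
have : x0 <= x0 - c.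
  apply: sup_le_ub; first by exists mu.
  apply: ubE => u; have := hc u; rewrite !qform_shift; lra.
by rewrite leNgt ltrBlDr ltrDl c0.
Qed.

End Rayleigh.

(** * The dynamics in eigen-coordinates *)

Section Overlap.
Variables (R : realType) (r : nat) (lam : nat -> R).
Variables (z x pi Q w : 'I_r.+1 -> R) (N kappa eps chi sigma Th P : R).

(** Write [x i = z i * pi i + p]. The product is then the noiseless term minus
    [(2 * pi i - 1) * p * z i + p ^+ 2], and [2 * pi i - 1] lies in [-1, 1]. The weight can only
    enlarge the main term and at most doubles the error. *)
Lemma overlap_term_ge i : 0 <= z i -> 0 <= pi i <= 1 ->
  `|x i - z i * pi i| <= Q i -> 1 <= w i <= 2 ->
  z i ^+ 2 * (pi i * (1 - pi i)) - 2 * (Q i * z i + Q i ^+ 2) <=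
  w i * ((z i - x i) * x i).
Proof.
move=> z0 /andP[pi0 pi1] + /andP[w1 w2].
have [p pE] : exists p, x i = z i * pi i + p.
  by exists (x i - z i * pi i); rewrite addrC subrK.
rewrite pE [z i * pi i + p]addrC addrK => pQ.
set A := z i ^+ 2 * _; set e := Q i * z i + Q i ^+ 2.
have A0 : 0 <= A by rewrite !mulr_ge0// ?sqr_ge0// subr_ge0.
have Q0 : 0 <= Q i by exact: le_trans pQ.
have e0 : 0 <= e by rewrite addr_ge0 ?mulr_ge0.
have h : A - e <= (z i - (p + z i * pi i)) * (p + z i * pi i).
  have -> : (z i - (p + z i * pi i)) * (p + z i * pi i) =
    A - ((2 * pi i - 1) * p * z i + p ^+ 2) by rewrite /A; ring.
  rewrite lerB// lerD//.
    rewrite ler_wpM2r// (le_trans (ler_norm _))// normrM.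
    rewrite -[leRHS]mul1r ler_pM// ler_norml; lra.
  by rewrite -real_normK ?num_real// lerXn2r ?nnegrE.
apply: (@le_trans _ _ (w i * (A - e))).
  have : 0 <= (w i - 1) * A by rewrite mulr_ge0// subr_ge0.
  have : 0 <= (2 - w i) * e by rewrite mulr_ge0// subr_ge0.
  lra.
by rewrite ler_wpM2l//; lra.
Qed.

(* [pi i] is the fraction of mode [i] that is still to be learned and [Th] the
   elapsed time.  Either some mode is half-learned to within a constant, or all
   modes are past one half and the total remaining residual is what counts. *)
Lemma overlap_gt0 :
  0 < N -> 0 < kappa -> 0 < eps -> 0 < sigma -> sigma <= 1 ->
  1 < chi -> sigma * (2 * chi) <= 1 ->
  nrm z = N -> (forall i, kappa * N <= z i) -> nrm Q <= P ->
  (forall i, 0 <= pi i <= 1) ->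
  (forall i, `|x i - z i * pi i| <= Q i) ->
  (forall i, 1 <= w i <= 2) ->
  2 * eps < nrm x ->
  (forall i : nat, (i < r)%N -> lam i <= chi * lam i.+1) ->
  0 <= Th -> sigma <= lam 0%N * Th ->
  (forall i, 1 - pi i <= lam i * Th) ->
  (forall i, pi i * (1 + lam i * Th) <= 1) ->
  2 * P <= N -> 6 * P < kappa * eps -> 12 * P < kappa ^+ 2 * N * sigma ->
  0 < \sum_i w i * ((z i - x i) * x i).
Proof.
move=> N0 k0 e0 s0 s1 chi1 schi zN kz QP pi01 xp w12 xe lamchi Th0 lam0.
move=> piT piT1 PN Pe Ps.
have z0 i : 0 <= z i by apply: le_trans (kz i); rewrite mulr_ge0// ltW.
have Q0 i : 0 <= Q i by exact: le_trans (xp i).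
have P0 : 0 <= P by exact: le_trans (nrm_ge0 _ _ _) QP.
have k1 : kappa <= 1.
  rewrite -(ler_pM2r N0) mul1r -zN (le_trans _ (le_nrm _ _ z 0))// zN.
  by rewrite (le_trans (kz 0))// ler_norm.
have A0 i : 0 <= z i ^+ 2 * (pi i * (1 - pi i)).
  have /andP[? ?] := pi01 i; rewrite mulr_ge0 ?sqr_ge0// mulr_ge0// subr_ge0//.
set A := \sum_i z i ^+ 2 * (pi i * (1 - pi i)).
(* Cauchy-Schwarz bounds the total error by [2 * (P * N + P ^+ 2)], and [2 * P <= N] absorbs the
   square. *)
have lowb : A - 3 * (P * N) <= \sum_i w i * ((z i - x i) * x i).
  apply: (@le_trans _ _ (\sum_i (z i ^+ 2 * (pi i * (1 - pi i))
      - 2 * (Q i * z i + Q i ^+ 2)))); last first.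
    by apply: ler_sum => i _; exact: overlap_term_ge.
  rewrite sumrB -mulr_sumr big_split/= -nrm_sqr lerD2l lerN2.
  have h1 : \sum_i Q i * z i <= P * N.
    by rewrite (le_trans (cauchy_schwarz _ _ _ _))// zN ler_wpM2r// ltW.
  have h2 : nrm Q ^+ 2 <= P ^+ 2 by rewrite lerXn2r ?nnegrE ?nrm_ge0.
  have : 2 * P ^+ 2 <= P * N by rewrite mulrCA ler_wpM2l.
  lra.
apply: lt_le_trans lowb; rewrite subr_gt0.
have [[i hi]|small] := pselect (exists i, 2^-1 <= pi i).
- pose E := [pred k : nat | [exists i : 'I_r.+1, (i == k :> nat) && (2^-1 <= pi i)]].
  have exE : exists k, E k.
    by exists (i : nat); apply/existsP; exists i; rewrite eqxx.
  case: (ex_minnP exE) => k /existsP[j /andP[/eqP jk pij]] kmin.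
  (* For [k = 0] this is a hypothesis. Otherwise the previous mode has [pi < 1/2], so its [lam * Th]
     exceeds 1/2; moving to the next mode loses a factor [chi], hence the condition
     [sigma * (2 * chi) <= 1]. *)
  have sj : sigma <= lam j * Th.
    case: k jk kmin => [j0 _|k jk kmin]; first by rewrite j0.
    have kr : (k < r.+1)%N by rewrite ltnW// -jk.
    have : pi (Ordinal kr) < 2^-1.
      rewrite ltNge; apply/negP => hk.
      have : E k by apply/existsP; exists (Ordinal kr); rewrite eqxx.
      by move=> /kmin; rewrite ltnn.
    have := piT (Ordinal kr); rewrite jk/=.
    have : lam k * Th <= chi * lam k.+1 * Th.
      by rewrite ler_wpM2r// lamchi// -ltnS -jk.
    move=> h1 h2 h3.
    have h4 : sigma * (2 * chi) <= chi * lam k.+1 * Th * 2 by lra.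
    rewrite -(@ler_pM2r _ (2 * chi)) ?mulr_gt0 ?(lt_trans _ chi1)//.
    by rewrite (le_trans h4)//; lra.
  apply: (@lt_le_trans _ _ (z j ^+ 2 * (pi j * (1 - pi j)))); last first.
    by rewrite /A (bigD1 j)//= lerDl sumr_ge0.
  (* From [pi j * (1 + sigma) <= 1] follows [1 - pi j >= pi j * sigma], and [pi j >= 1/2]. *)
  have pis : sigma / 2 <= 1 - pi j.
    have /andP[p0 p1] := pi01 j.
    have h1 : pi j * (1 + sigma) <= 1.
      by rewrite (le_trans _ (piT1 j))// ler_wpM2l// lerD2l.
    have : 0 <= (1 - sigma) * (1 - pi j) by rewrite mulr_ge0// subr_ge0.
    have : 0 <= (2 * pi j - 1) * sigma by rewrite mulr_ge0 ?(ltW s0)//; lra.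
    lra.
  have h4 : sigma / 4 <= pi j * (1 - pi j).
    have : 0 <= (pi j - 2^-1) * (1 - pi j) by rewrite mulr_ge0//; lra.
    lra.
  apply: (@lt_le_trans _ _ ((kappa * N) ^+ 2 * (sigma / 4))); last first.
    apply: ler_pM => //; rewrite ?sqr_ge0//; first by lra.
    by rewrite lerXn2r ?nnegrE// mulr_ge0// ltW.
  have -> : (kappa * N) ^+ 2 * (sigma / 4) =
    (kappa ^+ 2 * N * sigma / 4) * N by field.
  by rewrite mulrA ltr_pM2r//; lra.
have pih i : pi i <= 2^-1.
  by rewrite leNgt; apply/negP => h; apply: small; exists i; rewrite ltW.
(* Of [nrm x > 2 * eps] the noise removes at most [P < eps], and the sum of nonnegative entries
   dominates their Euclidean norm. *)
have zpi : eps < \sum_i z i * pi i.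
  apply: (@lt_le_trans _ _ (nrm (fun i => z i * pi i))); last first.
    by apply: nrm_le_sum => i; rewrite mulr_ge0//; have /andP[] := pi01 i.
  have : nrm x <= nrm (fun i => z i * pi i) + nrm (fun i => x i - z i * pi i).
    apply: le_trans (nrmD _ _ _ _).
    by rewrite (eq_nrm _ _ _ x)// => i; rewrite addrC subrK.
  have : nrm (fun i => x i - z i * pi i) <= P.
    exact: le_trans (ler_nrm _ _ _ _ xp) QP.
  have : kappa * eps <= eps by rewrite ler_piMl// ltW.
  lra.
apply: (@lt_le_trans _ _ (\sum_i (kappa * N / 2) * (z i * pi i))).
  rewrite -mulr_sumr.
  have : kappa * N * eps < kappa * N * \sum_i z i * pi i.
    by rewrite ltr_pM2l// mulr_gt0.
  have : (6 * P) * N < kappa * eps * N by rewrite ltr_pM2r.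
  lra.
apply: ler_sum => i _.
have /andP[p0 p1] := pi01 i.
have -> : z i ^+ 2 * (pi i * (1 - pi i)) = (z i * (1 - pi i)) * (z i * pi i) by ring.
rewrite ler_wpM2r ?mulr_ge0//.
have := pih i; have := ltW k0; have := ltW N0 => N0' k0' pi2.
by apply: ler_pM; [exact: mulr_ge0|rewrite invr_ge0|exact: kz|lra].
Qed.

End Overlap.

(** * Contraction of the modes under noise: an induction on time *)

Section Modes.
Variables (R : realType) (r : nat).
Variables (eta chi c1 kappa eps sigma n N m md : R) (lam : nat -> R).
Variables (z : 'I_r.+1 -> R) (x : nat -> 'I_r.+1 -> R).
Variables (G : nat -> 'I_r.+1 -> 'I_r.+1 -> R) (al : nat -> R).

(** The value of [- D^T F] when D has coordinates [- x] and F has coordinates [z - x]. *)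
Definition overlap t : R := \sum_i (z i - x t i) * x t i.
Definition gain t : R := 2 / (m * n) * (al t + md + 2 * eta / n * overlap t).

(* The drift is truncated so that [1 - drift t * lam i] is never negative; the
   excess is at most the size of [G] and is moved into [noise]. *)
Definition drift t : R := Num.min (eta * gain t) (lam 0%N)^-1.
Definition noise (t : nat) (i : 'I_r.+1) : R :=
  eta * (\sum_j G t i j * x t j) + (eta * gain t - drift t) * lam i * x t i.
Definition cnoise (t : nat) (i : 'I_r.+1) : R := \sum_(s < t) `|noise s i|.
(** Each summand is at most the decrease [drift * lam * |x|] of its mode once [drift >= eta / n],
    and it also controls the increments of [G]. *)
Definition travel (t : nat) (i : 'I_r.+1) : R := \sum_(s < t) eta / n * lam i * `|x s i|.
Definition clock t : R := \sum_(s < t) drift s.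
Definition decay (t : nat) (i : 'I_r.+1) : R := \prod_(s < t) (1 - drift s * lam i).
Definition env (t : nat) (i : 'I_r.+1) : R := z i + cnoise t i.

Hypotheses (eta0 : 0 < eta) (chi1 : 1 < chi) (c10 : 0 < c1) (ec1 : eta * c1 < 1).
Hypotheses (k0 : 0 < kappa) (e0 : 0 < eps) (n0 : 0 < n) (N0 : 0 < N) (m0 : 0 < m).
Hypotheses (NN : N ^+ 2 = n) (md0 : 0 <= md).
Hypotheses (s0 : 0 < sigma) (sec : sigma <= eta * c1) (schi : sigma * (2 * chi) <= 1).
Hypotheses (lam0 : lam 0%N = c1 * n) (lamr0 : 0 < lam r).
Hypothesis lamW : forall i : nat, (i <= r)%N -> lam r <= lam i <= lam 0%N.
Hypothesis lamchi : forall i : nat, (i < r)%N -> lam i <= chi * lam i.+1.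
Hypotheses (zN : nrm z = N) (kz : forall i, kappa * N <= z i).
(** The price of noise in units of lost residual: [c] times the decay rate [eta * lam r / (2 * n)]
    equals [80 * eta / m], which exceeds the noise rate [72 * eta / m]. *)
Let c := 160 * n / (m * lam r).
Hypotheses (cN : 2 * c <= 1) (ce : 6 * (c * N) < kappa * eps).
Hypothesis cs : 12 * (c * N) < kappa ^+ 2 * N * sigma.

Hypothesis x0E : forall i, x 0%N i = z i.
Hypothesis xS : forall t i,
  x t.+1 i = x t i - eta * (gain t * lam i * x t i + \sum_j G t i j * x t j).
Hypothesis G0E : forall i j, G 0%N i j = 0.
Hypothesis GS : forall t i j, G t.+1 i j = G t i j +
  2 / (m * n) * (2 * eta / n * (lam i * x t i * (z j - x t j) +
                                (z i - x t i) * (lam j * x t j))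
    + 4 * eta ^+ 2 / (n ^+ 2 * m) * al t * (lam i * x t i * (lam j * x t j))).
Hypothesis al0E : al 0%N = m.
Hypothesis alS : forall t, al t + 4 * eta / n * overlap t <= al t.+1.

(** The second clause is the Rayleigh quotient of [eta * M^*] at the top eigenvector of [X^T X]. *)
Definition running t : Prop :=
  2 * eps < nrm (x t) /\ eta * gain t * lam 0%N + eta * G t ord0 ord0 <= 1.

(** [inv_travel] is the telescoped contraction of each mode. The asymmetric 3 in [inv_G] absorbs the
    second-order term of the recursion for [G]. [inv_potential] charges all noise to the loss of
    [nrm x]. [inv_decay_le] says that [decay] is at most [1 / (1 + lam * clock)]. *)
Record invariant t : Prop := Invariant {
  inv_travel : forall i, `|x t i| + travel t i <= env t i;
  inv_noise : forall i, `|x t i - z i * decay t i| <= cnoise t i;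
  inv_G : forall i j, `|G t i j| <=
    4 / (m * n) * (3 * travel t i * env t j + env t i * travel t j);
  inv_potential : nrm (cnoise t) <= c * (N - nrm (x t));
  inv_al : m <= al t;
  inv_decay : forall i, 0 <= decay t i <= 1;
  inv_decay_ge : forall i, 1 - decay t i <= lam i * clock t;
  inv_decay_le : forall i, decay t i * (1 + lam i * clock t) <= 1;
  inv_clock : t%:R * (eta / n) <= clock t }.

Lemma lam_gt0 (i : 'I_r.+1) : 0 < lam i.
Proof.
have /andP[+ _] := lamW i (ltn_ord i).
exact: lt_le_trans lamr0.
Qed.

Lemma lam_le (i : 'I_r.+1) : lam i <= c1 * n.
Proof. by rewrite -lam0; have /andP[] := lamW i (ltn_ord i). Qed.

Lemma z_ge0 i : 0 <= z i.
Proof. by apply: le_trans (kz i); rewrite mulr_ge0// ltW. Qed.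

Lemma c_gt0 : 0 < c.
Proof. by rewrite /c divr_gt0// mulr_gt0. Qed.

Lemma cnoise_ge0 t i : 0 <= cnoise t i.
Proof. exact: sumr_ge0. Qed.

Lemma travel_ge0 t i : 0 <= travel t i.
Proof.
apply: sumr_ge0 => s _; apply: mulr_ge0 => //.
by apply: mulr_ge0; [apply: divr_ge0|]; apply: ltW => //; exact: lam_gt0.
Qed.

Lemma env_ge0 t i : 0 <= env t i.
Proof. by rewrite addr_ge0 ?z_ge0 ?cnoise_ge0. Qed.

Lemma c_le_rate : 320 * n <= m * lam r.
Proof.
have := cN; rewrite /c mulrA ler_pdivrMr ?mulr_gt0// mul1r; lra.
Qed.

Lemma eta_div_m_le : 320 * (eta / m) <= eta * lam r / n.
Proof.
rewrite ler_pdivlMr// mulrA -mulrAC ler_pdivrMr//.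
rewrite (_ : 320 * eta * n = eta * (320 * n)); last by ring.
by rewrite -mulrA ler_pM2l// [lam r * m]mulrC c_le_rate.
Qed.

Section AtInvariant.
Variable t : nat.
Hypothesis It : invariant t.

Lemma nrm_cnoise_le : nrm (cnoise t) <= c * N.
Proof.
apply: (le_trans (inv_potential _ It)).
by rewrite ler_wpM2l ?(ltW c_gt0)// gerBl nrm_ge0.
Qed.

(** The noise has norm at most [c * N <= N / 2], so [env] has norm at most [3 / 2 * N]. *)
Lemma nrm_env_sqr_le : 4 * nrm (env t) ^+ 2 <= 9 * n.
Proof.
have h : nrm (env t) <= 3 / 2 * N.
  apply: (le_trans (nrmD _ _ _ _)); rewrite zN.
  have := nrm_cnoise_le; have : 2 * c * N <= 1 * N by rewrite ler_wpM2r// ltW.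
  lra.
have : nrm (env t) ^+ 2 <= (3 / 2 * N) ^+ 2.
  by rewrite lerXn2r ?nnegrE ?nrm_ge0// (le_trans _ h)// nrm_ge0.
rewrite exprMn NN; lra.
Qed.

Lemma travel_le_env i : travel t i <= env t i.
Proof. by apply: le_trans (inv_travel _ It i); rewrite lerDr. Qed.

Lemma x_le_env i : `|x t i| <= env t i.
Proof. by apply: le_trans (inv_travel _ It i); rewrite lerDl travel_ge0. Qed.

(** Compare [x] with the noiseless value [z * decay]: the learned part lies between 0 and [z], and
    the deviation is at most [cnoise]. *)
Lemma zx_le_env i : `|z i - x t i| <= env t i.
Proof.
have /andP[d0 d1] := inv_decay _ It i.
have -> : z i - x t i = z i * (1 - decay t i) - (x t i - z i * decay t i) by ring.
apply: (le_trans (ler_normB _ _)); apply: lerD; last exact: inv_noise.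
rewrite ger0_norm ?mulr_ge0 ?z_ge0 ?subr_ge0//.
by rewrite ler_piMr ?z_ge0// gerBl.
Qed.

Lemma G_le_env i j : `|G t i j| <= 16 / (m * n) * (env t i * env t j).
Proof.
apply: (le_trans (inv_G _ It i j)).
have -> : 16 / (m * n) * (env t i * env t j) =
  4 / (m * n) * (3 * env t i * env t j + env t i * env t j).
  by field; rewrite !gt_eqF.
rewrite ler_wpM2l ?divr_ge0 ?mulr_ge0 ?(ltW m0) ?(ltW n0)// lerD//.
  by rewrite ler_wpM2r ?env_ge0// ler_wpM2l// travel_le_env.
by rewrite ler_wpM2l ?env_ge0// travel_le_env.
Qed.

(** The source of 36: the factor 16 of [G_le_env] times 9/4 from [nrm_env_sqr_le]. *)
Lemma env_sqr_div : 16 / (m * n) * nrm (env t) ^+ 2 <= 36 / m.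
Proof.
have -> : 36 / m = 4 / (m * n) * (9 * n) by field; rewrite !gt_eqF.
have -> : 16 / (m * n) * nrm (env t) ^+ 2 = 4 / (m * n) * (4 * nrm (env t) ^+ 2).
  by field; rewrite !gt_eqF.
by rewrite ler_wpM2l ?nrm_env_sqr_le// divr_ge0// mulr_ge0// ltW.
Qed.

Lemma nrm_G_le (u : 'I_r.+1 -> R) :
  nrm (fun i => \sum_j G t i j * u j) <= 36 / m * nrm u.
Proof.
apply: (@le_trans _ _ (16 / (m * n) * nrm (env t) ^+ 2 * nrm u)).
  apply: nrm_rank1_dominated; last exact: G_le_env.
    by rewrite divr_ge0// mulr_ge0// ltW.
  exact: env_ge0.
by rewrite ler_wpM2r ?nrm_ge0// env_sqr_div.
Qed.

Lemma G00_le : `|G t ord0 ord0| <= 36 / m.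
Proof.
apply: (le_trans (G_le_env _ _)); apply: le_trans env_sqr_div.
rewrite ler_wpM2l ?divr_ge0 ?mulr_ge0 ?(ltW m0) ?(ltW n0)//.
rewrite -expr2 lerXn2r ?nnegrE ?env_ge0 ?nrm_ge0//.
exact: le_trans (ler_norm _) (le_nrm _ _ _ _).
Qed.

(** After one step [clock] is at least [eta / n], so the top mode has
    [lam * clock >= eta * c1 >= sigma]; this is where [0 < t] enters. *)
Lemma weighted_overlap_gt0 (w : 'I_r.+1 -> R) : (0 < t)%N -> 2 * eps < nrm (x t) ->
  (forall i, 1 <= w i <= 2) -> 0 < \sum_i w i * ((z i - x t i) * x t i).
Proof.
move=> t0 xe w12.
have ct : eta / n <= clock t.
  apply: le_trans (inv_clock _ It); rewrite ler_peMl ?divr_ge0 ?(ltW eta0) ?(ltW n0)//.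
  by rewrite ler1n.
have ct0 : 0 <= clock t by rewrite (le_trans _ ct)// divr_ge0// ltW.
apply: (overlap_gt0 _ _ lam z (x t) (decay t) (cnoise t) w N kappa eps chi sigma
  (clock t) (c * N)) => //.
- by rewrite (le_trans sec)// ltW.
- exact: nrm_cnoise_le.
- exact: inv_decay.
- exact: inv_noise.
- rewrite (le_trans sec)// lam0 (le_trans _ (ler_wpM2l _ ct)) ?mulr_ge0 ?(ltW c10) ?(ltW n0)//.
  by rewrite (_ : c1 * n * (eta / n) = eta * c1)//; field; rewrite gt_eqF.
- exact: inv_decay_ge.
- exact: inv_decay_le.
- by rewrite mulrA ler_piMl// ltW.
Qed.

Hypothesis rt : running t.

Lemma overlap_ge0 : 0 <= overlap t.
Proof.
have [t0|t0] := posnP t.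
  by rewrite /overlap t0 big1// => i _; rewrite x0E subrr mul0r.
have := weighted_overlap_gt0 (fun=> 1) t0 rt.1.
under eq_bigr do rewrite mul1r.
by move=> h; apply: ltW; apply: h => i; rewrite lexx/= ler1n.
Qed.

Lemma gain_ge : al t * (2 / (m * n)) <= gain t.
Proof.
rewrite /gain mulrC ler_wpM2l ?divr_ge0 ?mulr_ge0 ?(ltW m0) ?(ltW n0)//.
rewrite -addrA lerDl addr_ge0// mulr_ge0 ?overlap_ge0//.
by rewrite !mulr_ge0 ?invr_ge0 ?(ltW eta0) ?(ltW n0).
Qed.

Lemma gain_ge_inv : 2 / n <= gain t.
Proof.
apply: le_trans gain_ge.
rewrite (_ : 2 / n = m * (2 / (m * n))); last by field; rewrite !gt_eqF.
by rewrite ler_wpM2r ?inv_al// divr_ge0// mulr_ge0// ltW.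
Qed.

(** The untruncated value is at least [2 * eta / n]; the truncated one, [1 / (c1 * n)], is large
    enough because [eta * c1 < 1]. *)
Lemma drift_ge : eta / n <= drift t.
Proof.
rewrite le_min; apply/andP; split.
  apply: (@le_trans _ _ (eta * (2 / n))).
    by rewrite ler_pM2l// ler_peMl ?invr_ge0 ?(ltW n0)// ler1n.
  by rewrite ler_pM2l// gain_ge_inv.
rewrite lam0 -[leRHS]mul1r ler_pdivlMr ?mulr_gt0//.
rewrite (_ : eta / n * (c1 * n) = eta * c1) ?(ltW ec1)//.
by field; rewrite gt_eqF.
Qed.

Lemma drift_ge0 : 0 <= drift t.
Proof. by apply: le_trans drift_ge; rewrite divr_ge0// ltW. Qed.

Lemma drift_lam (i : 'I_r.+1) : 0 <= drift t * lam i <= 1.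
Proof.
rewrite mulr_ge0 ?drift_ge0 ?(ltW (lam_gt0 i))//=.
have l0 : 0 < lam 0%N by rewrite lam0 mulr_gt0.
apply: (@le_trans _ _ ((lam 0%N)^-1 * lam 0%N)); last by rewrite mulVf ?gt_eqF.
apply: ler_pM; rewrite ?drift_ge0 ?(ltW (lam_gt0 i))//.
  by rewrite ge_min lexx orbT.
by rewrite lam0 lam_le.
Qed.

(** If the truncation is active, [drift * lam 0 = 1], and the sharpness clause of [running] bounds
    [eta * gain * lam 0 - 1] by [- eta * G 0 0]. *)
Lemma excess (i : 'I_r.+1) :
  0 <= (eta * gain t - drift t) * lam i <= 36 * (eta / m).
Proof.
have ex0 : 0 <= eta * gain t - drift t by rewrite subr_ge0 ge_min lexx.
rewrite mulr_ge0 ?(ltW (lam_gt0 i))//=.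
have l0 : 0 < lam 0%N by rewrite lam0 mulr_gt0.
apply: (@le_trans _ _ ((eta * gain t - drift t) * lam 0%N)).
  by rewrite ler_wpM2l// lam0 lam_le.
rewrite /drift minElt; case: ifPn => _.
  by rewrite subrr mul0r mulr_ge0// divr_ge0// ltW.
rewrite mulrBl mulVf ?gt_eqF//.
have [_ h] := rt.
have : eta * - (36 / m) <= eta * G t ord0 ord0.
  by rewrite ler_pM2l//; have := G00_le; rewrite ler_norml => /andP[].
lra.
Qed.

(** The sharpness clause gives [2 * eta * c1 * al / m <= 1 + 36 * eta / m], and [eta / m] is at most
    1/320. *)
Lemma al_le : eta * c1 * al t <= m.
Proof.
have [_ h] := rt.
have h1 : eta * - (36 / m) <= eta * G t ord0 ord0.
  by rewrite ler_pM2l//; have := G00_le; rewrite ler_norml => /andP[].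
have h2 : eta * (al t * (2 / (m * n))) * lam 0%N <= eta * gain t * lam 0%N.
  by rewrite ler_pM2r ?lam0 ?mulr_gt0// ler_pM2l// gain_ge.
have h3 : 320 * (eta / m) <= 1.
  apply: (le_trans eta_div_m_le); rewrite ler_pdivrMr// mul1r.
  apply: (@le_trans _ _ (eta * (c1 * n))).
    by rewrite ler_pM2l// (lam_le ord_max).
  by rewrite mulrA ler_piMl// ltW.
have h4 : eta * (al t * (2 / (m * n))) * lam 0%N = 2 * (eta * c1 * al t / m).
  by rewrite lam0; field; rewrite !gt_eqF.
have : eta * c1 * al t / m <= 1 by lra.
by rewrite ler_pdivrMr// mul1r.
Qed.

(** One 36 comes from [G], the other from the truncation of [drift]. *)
Lemma nrm_noise_le : nrm (noise t) <= 72 * (eta / m) * nrm (x t).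
Proof.
apply: (le_trans (nrmD _ _ _ _)); rewrite nrmZ ger0_norm ?(ltW eta0)//.
have h1 : eta * nrm (fun i => \sum_j G t i j * x t j) <= eta * (36 / m * nrm (x t)).
  by rewrite ler_pM2l// nrm_G_le.
have h2 : nrm (fun i : 'I_r.+1 => (eta * gain t - drift t) * lam i * x t i) <=
    36 * (eta / m) * nrm (x t).
  have em : 0 <= 36 * (eta / m) by rewrite mulr_ge0// divr_ge0// ltW.
  rewrite -[36 * _]ger0_norm// -nrmZ.
  apply: (@le_trans _ _ (nrm (fun i => `|36 * (eta / m) * x t i|))).
    apply: ler_nrm => i; have /andP[ex0 ex1] := excess i.
    by rewrite normrM [leRHS]normrM ler_wpM2r// !ger0_norm.
  rewrite le_eqVlt; apply/orP; left; apply/eqP; congr Num.sqrt.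
  by apply: eq_bigr => i _; rewrite real_normK ?num_real.
lra.
Qed.

Lemma x_step i : x t.+1 i = (1 - drift t * lam i) * x t i - noise t i.
Proof. rewrite xS /noise; ring. Qed.

Lemma nrm_x_step :
  nrm (x t.+1) <= (1 - drift t * lam r) * nrm (x t) + nrm (noise t).
Proof.
pose y (i : 'I_r.+1) := (1 - drift t * lam i) * x t i.
apply: (@le_trans _ _ (nrm y + nrm (fun i => -1 * noise t i))).
  apply: le_trans (nrmD _ _ _ _).
  by rewrite le_eqVlt; apply/orP; left; apply/eqP; apply: eq_nrm => i; rewrite x_step mulN1r.
rewrite nrmZ normrN1 mul1r lerD2r.
have /andP[_ r1] := drift_lam ord_max.
rewrite -[1 - _]ger0_norm ?subr_ge0// -nrmZ.
have -> : nrm (fun i => (1 - drift t * lam r) * x t i) =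
    nrm (fun i => `|(1 - drift t * lam r) * x t i|).
  by congr Num.sqrt; apply: eq_bigr => i _; rewrite real_normK ?num_real.
apply: ler_nrm => i; rewrite normrM [leRHS]normrM ler_wpM2r//.
have /andP[_ i1] := drift_lam i.
rewrite !ger0_norm ?subr_ge0// lerD2l lerN2 ler_wpM2l ?drift_ge0//.
by have /andP[] := lamW i (ltn_ord i).
Qed.

(** The slowest contraction rate is at least [320 * eta / m], so noise at rate [72 * eta / m] spoils
    less than half of it; the remaining decrease, multiplied by [c], still pays for the noise. *)
Lemma nrm_noise_le_potential :
  nrm (noise t) <= c * (nrm (x t) - nrm (x t.+1)).
Proof.
have hq := nrm_noise_le; have hx := nrm_x_step.
have x0 := nrm_ge0 _ _ (x t).
have h1 : eta * lam r / n * nrm (x t) <= drift t * lam r * nrm (x t).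
  by rewrite ler_wpM2r// mulrAC ler_pM2r// drift_ge.
have h2 : 320 * (eta / m) * nrm (x t) <= eta * lam r / n * nrm (x t).
  by rewrite ler_wpM2r// eta_div_m_le.
have h0 : 0 <= eta / m * nrm (x t) by rewrite mulr_ge0// divr_ge0// ltW.
have h3 : eta * lam r / n * nrm (x t) / 2 <= nrm (x t) - nrm (x t.+1) by lra.
have := ler_wpM2l (ltW c_gt0) h3.
have -> : c * (eta * lam r / n * nrm (x t) / 2) = 80 * (eta / m) * nrm (x t).
  by rewrite /c; field; rewrite !gt_eqF.
lra.
Qed.

Lemma abs_x_step i :
  `|x t.+1 i| <= (1 - drift t * lam i) * `|x t i| + `|noise t i|.
Proof.
rewrite x_step (le_trans (ler_normB _ _))// lerD2r normrM ger0_norm//.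
by rewrite subr_ge0; have /andP[] := drift_lam i.
Qed.

Let u (i : 'I_r.+1) := eta / n * lam i * `|x t i|.

Lemma speed_ge0 i : 0 <= u i.
Proof. by rewrite !mulr_ge0 ?invr_ge0 ?(ltW eta0) ?(ltW n0) ?(ltW (lam_gt0 i)). Qed.

Lemma travel_step i : `|x t.+1 i| + travel t.+1 i <= env t.+1 i.
Proof.
rewrite /env /cnoise /travel !big_ord_recr/= -/(travel t i) -/(cnoise t i).
have := abs_x_step i; have := inv_travel _ It i; rewrite /env.
have : u i <= drift t * lam i * `|x t i|.
  by rewrite /u !ler_wpM2r ?(ltW (lam_gt0 i))// drift_ge.
rewrite /u; lra.
Qed.

(** The deviation from the noiseless solution is multiplied by the same factor, which lies in
    [0, 1], so past noise is never amplified. *)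
Lemma noise_step i : `|x t.+1 i - z i * decay t.+1 i| <= cnoise t.+1 i.
Proof.
rewrite /decay /cnoise !big_ord_recr/= -/(decay t i) -/(cnoise t i) x_step.
have -> : (1 - drift t * lam i) * x t i - noise t i -
    z i * (decay t i * (1 - drift t * lam i)) =
    (1 - drift t * lam i) * (x t i - z i * decay t i) - noise t i by ring.
rewrite (le_trans (ler_normB _ _))// lerD2r normrM.
have /andP[d0 d1] := drift_lam i.
rewrite ger0_norm ?subr_ge0// (le_trans _ (inv_noise _ It i))//.
by rewrite ler_piMl// gerBl.
Qed.

Lemma G_increment_le i j :
  `|G t.+1 i j - G t i j| <= 4 / (m * n) * (3 * u i * env t j + env t i * u j).
Proof.
rewrite GS [X in `|X|]addrC addKr.
set h := _ + 4 * eta ^+ 2 / _ * _ * _.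
rewrite normrM [`|2 / _|]ger0_norm ?divr_ge0 ?mulr_ge0 ?(ltW m0) ?(ltW n0)//.
have -> : 4 / (m * n) * (3 * u i * env t j + env t i * u j) =
  2 / (m * n) * (2 * (3 * u i * env t j + env t i * u j)).
  by field; rewrite !gt_eqF.
rewrite ler_wpM2l ?divr_ge0 ?mulr_ge0 ?(ltW m0) ?(ltW n0)//.
have absu (l : 'I_r.+1) : `|eta / n * (lam l * x t l)| = u l.
  by rewrite mulrA normrM ger0_norm// mulr_ge0 ?divr_ge0 ?(ltW eta0) ?(ltW n0) ?(ltW (lam_gt0 l)).
have hE : h = 2 * (eta / n * (lam i * x t i) * (z j - x t j))
  + 2 * ((z i - x t i) * (eta / n * (lam j * x t j)))
  + 4 * (al t / m) * (eta / n * (lam i * x t i) * (eta / n * (lam j * x t j))).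
  by rewrite /h; field; rewrite !gt_eqF.
rewrite hE (le_trans (ler_normD _ _))//.
have a0 : 0 <= al t / m.
  by rewrite divr_ge0 ?(ltW m0)// (le_trans _ (inv_al _ It))// ltW.
have t1 : `|2 * (eta / n * (lam i * x t i) * (z j - x t j))| <= 2 * (u i * env t j).
  by rewrite normrM [`|2|]ger0_norm// ler_pM2l// normrM absu ler_wpM2l ?speed_ge0// zx_le_env.
have t2 : `|2 * ((z i - x t i) * (eta / n * (lam j * x t j)))| <= 2 * (env t i * u j).
  by rewrite normrM [`|2|]ger0_norm// ler_pM2l// normrM absu ler_wpM2r ?speed_ge0// zx_le_env.
(* The second-order term is [4 * (al t / m) * (u i * u j)]. Here [u j <= eta * c1 * env t j], and
   [al_le] cancels [eta * c1] against [al t / m]. *)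
have t3 : `|4 * (al t / m) * (eta / n * (lam i * x t i) * (eta / n * (lam j * x t j)))|
    <= 4 * (u i * env t j).
  have a4 : 0 <= 4 * (al t / m) by exact: mulr_ge0.
  rewrite normrM (ger0_norm a4) normrM !absu -mulrA ler_pM2l//.
  rewrite mulrCA ler_wpM2l ?speed_ge0//.
  apply: (@le_trans _ _ (al t / m * (eta * c1 * env t j))).
    rewrite ler_wpM2l// /u; apply: ler_pM; rewrite ?x_le_env//.
      by rewrite mulr_ge0 ?divr_ge0 ?(ltW eta0) ?(ltW n0) ?(ltW (lam_gt0 j)).
    rewrite mulrAC ler_pdivrMr// -mulrA ler_pM2l//; exact: lam_le.
  rewrite mulrA ler_piMl ?env_ge0// mulrAC ler_pdivrMr// mul1r mulrC.
  exact: al_le.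
have := ler_normD (2 * (eta / n * (lam i * x t i) * (z j - x t j)))
  (2 * ((z i - x t i) * (eta / n * (lam j * x t j)))).
lra.
Qed.

Lemma env_le i : env t i <= env t.+1 i.
Proof. by rewrite /env /cnoise big_ord_recr/= lerD2l lerDl. Qed.

Lemma invariantS : invariant t.+1.
Proof.
have tS (i : 'I_r.+1) : travel t.+1 i = travel t i + u i by rewrite /travel big_ord_recr.
have cS : clock t.+1 = clock t + drift t by rewrite /clock big_ord_recr.
have dS (i : 'I_r.+1) : decay t.+1 i = decay t i * (1 - drift t * lam i).
  by rewrite /decay big_ord_recr.
have dl (i : 'I_r.+1) : 0 <= drift t * lam i <= 1 by exact: drift_lam.
have ct0 : 0 <= clock t.
  apply: le_trans (inv_clock _ It); rewrite mulr_ge0// divr_ge0// ltW//.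
split.
- exact: travel_step.
- exact: noise_step.
- move=> i j; rewrite -[G t.+1 i j](subrK (G t i j)) (le_trans (ler_normD _ _))//.
  apply: (le_trans (lerD (G_increment_le i j) (inv_G _ It i j))).
  rewrite -mulrDr ler_wpM2l ?divr_ge0 ?mulr_ge0 ?(ltW m0) ?(ltW n0)// !tS.
  have ui := speed_ge0 i; have uj := speed_ge0 j.
  (* Since [env] grows with time, the old envelopes may be replaced by the new ones. *)
  have h1 : (travel t i + u i) * env t j <= (travel t i + u i) * env t.+1 j.
    by rewrite ler_wpM2l ?env_le// addr_ge0// travel_ge0.
  have h2 : env t i * (travel t j + u j) <= env t.+1 i * (travel t j + u j).
    by rewrite ler_wpM2r ?env_le// addr_ge0// travel_ge0.
  lra.
- apply: (@le_trans _ _ (nrm (cnoise t) + nrm (noise t))).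
    have -> : nrm (noise t) = nrm (fun i => `|noise t i|).
      by congr Num.sqrt; apply: eq_bigr => i _; rewrite real_normK ?num_real.
    apply: le_trans (nrmD _ _ _ _); rewrite le_eqVlt; apply/orP; left; apply/eqP.
    by apply: eq_nrm => i; rewrite /cnoise big_ord_recr.
  have := inv_potential _ It; have := nrm_noise_le_potential; lra.
- apply: le_trans (alS t); rewrite -[m]addr0 lerD ?inv_al// mulr_ge0 ?overlap_ge0//.
  by rewrite !mulr_ge0 ?invr_ge0 ?(ltW eta0) ?(ltW n0).
- move=> i; rewrite dS; have /andP[a b] := dl i; have /andP[p q] := inv_decay _ It i.
  by rewrite mulr_ge0 ?subr_ge0//= mulr_ile1 ?subr_ge0// gerBl.
- move=> i; rewrite dS cS; have /andP[a b] := dl i; have /andP[p q] := inv_decay _ It i.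
  have := inv_decay_ge _ It i; have : decay t i * (drift t * lam i) <= drift t * lam i.
    by rewrite ler_piMl.
  lra.
- move=> i; rewrite dS cS; have /andP[a b] := dl i; have /andP[p q] := inv_decay _ It i.
  set aa := drift t * lam i.
  (* The new product is at most [(1 - aa) + (1 - aa) * aa = 1 - aa ^+ 2]. *)
  have h1 : (1 - aa) * (decay t i * (1 + lam i * clock t)) <= (1 - aa) * 1.
    by rewrite ler_wpM2l ?subr_ge0// inv_decay_le.
  have h2 : decay t i * ((1 - aa) * aa) <= (1 - aa) * aa.
    by rewrite ler_piMl// mulr_ge0// subr_ge0.
  have h3 : 0 <= aa * aa by rewrite mulr_ge0.
  have -> : decay t i * (1 - aa) * (1 + lam i * (clock t + drift t)) =
    (1 - aa) * (decay t i * (1 + lam i * clock t)) + decay t i * ((1 - aa) * aa).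
    by rewrite /aa; ring.
  lra.
- by rewrite cS -natr1 mulrDl mul1r lerD ?inv_clock ?drift_ge.
Qed.

End AtInvariant.

Lemma invariant0 : invariant 0.
Proof.
have E (F : nat -> R) : \sum_(s < 0) F s = 0 by rewrite big_ord0.
have d0 (i : 'I_r.+1) : decay 0 i = 1 by rewrite /decay big_ord0.
have cl : clock 0 = 0 by rewrite /clock big_ord0.
have cn (i : 'I_r.+1) : cnoise 0 i = 0 by rewrite /cnoise big_ord0.
have tr (i : 'I_r.+1) : travel 0 i = 0 by rewrite /travel big_ord0.
split => [i|i|i j|||i|i|i|].
- by rewrite tr /env cn !addr0 x0E ger0_norm// z_ge0.
- by rewrite d0 mulr1 x0E subrr normr0 cn.
- by rewrite G0E normr0 !tr mulr0 mul0r mulr0 addr0 mulr0.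
- rewrite (eq_nrm _ _ _ z x0E) zN subrr mulr0 /nrm big1 ?sqrtr0// => i _.
  by rewrite cn expr0n.
- by rewrite al0E.
- by rewrite d0 ler01 lexx.
- by rewrite d0 cl subrr mulr0.
- by rewrite d0 cl mulr0 addr0 mulr1.
- by rewrite cl mul0r.
Qed.

Lemma invariant_running t : (forall s, (s < t)%N -> running s) -> invariant t.
Proof.
elim: t => [_|t IH h]; first exact: invariant0.
by apply: invariantS; [apply: IH => s st; apply: h; rewrite ltnW|exact: h].
Qed.

Lemma running_bounds t : (0 < t)%N -> (forall s, (s <= t)%N -> running s) ->
  (forall u : 'I_r.+1 -> R,
     nrm (fun i => \sum_j G t i j * u j) <= 36 / m * nrm u) /\
  (forall w : 'I_r.+1 -> R, (forall i, 1 <= w i <= 2) ->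
     0 < \sum_i w i * ((z i - x t i) * x t i)).
Proof.
move=> t0 ht.
have It : invariant t.
  by apply: invariant_running => s st; apply: ht; rewrite ltnW.
split => [u|w w12]; first exact: nrm_G_le.
by apply: weighted_overlap_gt0 => //; have [] := ht t (leqnn t).
Qed.

End Modes.

(** * Reduction of gradient descent to eigen-coordinates *)

Section SquaredNorm.
Variable R : realType.

Lemma sc_sqnorm k (u : 'cV[R]_k) : u^T *m u = (sqnorm u)%:M.
Proof.
rewrite [LHS]mx11_scalar mxE; congr (_%:M).
by apply: eq_bigr => i _; rewrite mxE expr2.
Qed.

Lemma sc_scalar (a : R) : sc a%:M = a.
Proof. by rewrite /sc mxE eqxx mulr1n. Qed.

Lemma sqnorm_ge0 k (u : 'cV[R]_k) : 0 <= sqnorm u.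
Proof. by apply: sumr_ge0 => i _; exact: sqr_ge0. Qed.

Lemma sqnormBZ k (c : R) (u w : 'cV[R]_k) :
  sqnorm (u - c *: w) = sqnorm u - 2 * c * sc (u^T *m w) + c ^+ 2 * sqnorm w.
Proof.
rewrite /sqnorm /sc mxE !mulr_sumr -sumrB -big_split/=.
by apply: eq_bigr => i _; rewrite !mxE; ring.
Qed.

End SquaredNorm.

(** * One step of gradient descent in matrix form *)

Section GradientStep.
Variables (R : realType) (d n m : nat) (eta : R).
Variables (X : 'M[R]_(d, n)) (Y : 'cV[R]_n) (A : 'cV[R]_m) (W : 'M[R]_(m, d)).
Variables (F D : 'cV[R]_n).
Hypotheses (n0 : (0 < n)%N) (m0 : (0 < m)%N).
Hypotheses (FE : F = outF X A W) (DE : D = resD X Y A W).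

Let q : R := Num.sqrt m%:R.
Let s : R := 2 * eta / (n%:R * q).
Let K := X^T *m X.
Let H := X^T *m W^T *m W *m X.
Let A' := (gd_step eta X Y (A, W)).1.
Let W' := (gd_step eta X Y (A, W)).2.

Let q0 : q != 0.
Proof. by rewrite gt_eqF// sqrtr_gt0 ltr0n. Qed.

Let n0R : n%:R != 0 :> R.
Proof. by rewrite pnatr_eq0 -lt0n. Qed.

Let q2 : m%:R = q ^+ 2.
Proof. by rewrite sqr_sqrtr. Qed.

Let XWA : X^T *m W^T *m A = q *: F.
Proof. by rewrite FE /outF scalerA mulfV// scale1r. Qed.

Let AWX : A^T *m W *m X = q *: F^T.
Proof.
by have := congr1 trmx XWA; rewrite !trmx_mul !trmxK linearZ/= mulmxA.
Qed.

Let AWXD : A^T *m (W *m X *m D) = (q * sc (F^T *m D))%:M.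
Proof.
by rewrite !mulmxA AWX -scalemxAl {1}[F^T *m D]mx11_scalar scale_scalar_mx.
Qed.

Let XW' : X^T *m W'^T = X^T *m W^T - s *: (K *m D *m A^T).
Proof.
rewrite /W' /gd_step/= -DE linearB/= linearZ/= !trmx_mul !trmxK mulmxBr -scalemxAr.
by rewrite !mulmxA.
Qed.

(** The product of the two updates gives the term of order [eta ^+ 2]; since [A^T W X] is
    [q *: F^T], it is a multiple of [K *m D]. This is the correction that separates [Mstar] from
    [Mt]. *)
Lemma gd_step_outF : outF X A' W' = F
  - (2 * eta / (n%:R * m%:R)) *: (H *m D + sqnorm A *: (K *m D))
  + (4 * eta ^+ 2 / (n%:R ^+ 2 * m%:R) * sc (F^T *m D)) *: (K *m D).
Proof.
rewrite {1}/outF XW' {1}/A' /gd_step/= -DE -/q -/s.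
rewrite mulmxBr !mulmxBl -!scalemxAl -!scalemxAr.
have -> : K *m D *m A^T *m A = sqnorm A *: (K *m D).
  by rewrite -mulmxA sc_sqnorm mul_mx_scalar.
have -> : K *m D *m A^T *m (W *m X *m D) = (q * sc (F^T *m D)) *: (K *m D).
  by rewrite -[LHS]mulmxA AWXD mul_mx_scalar.
have -> : X^T *m W^T *m (W *m X *m D) = H *m D by rewrite !mulmxA.
rewrite XWA /s q2; move: (H *m D) (K *m D) (sc (F^T *m D)) => HD KD fd.
apply/matrixP => i j; rewrite !mxE; field.
by rewrite q0 n0R.
Qed.

(** [W *m X] changes by a rank-one matrix with left factor [A]. Pairing [A] with [W *m X] yields
    [F], and with itself [sqnorm A], so the increment involves [W] only through [F] and [D]. *)
Lemma gd_step_gram : X^T *m W'^T *m W' *m X = H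
  - (2 * eta / n%:R) *: (K *m D *m F^T + F *m (K *m D)^T)
  + (4 * eta ^+ 2 / (n%:R ^+ 2 * m%:R) * sqnorm A) *: (K *m D *m (K *m D)^T).
Proof.
have W'X : W' *m X = (X^T *m W'^T)^T by rewrite trmx_mul !trmxK.
rewrite -mulmxA W'X XW' [(_ - _)^T]linearB/= [(_ *: _)^T]linearZ/= !trmx_mul !trmxK.
rewrite mulmxBr !mulmxBl -!scalemxAl -!scalemxAr.
rewrite -/K.
have -> : X^T *m W^T *m (A *m (D^T *m K)) = q *: (F *m (D^T *m K)).
  by rewrite mulmxA XWA scalemxAl.
have -> : K *m D *m A^T *m (W *m X) = q *: (K *m D *m F^T).
  by rewrite -[LHS]mulmxA [A^T *m _]mulmxA AWX scalemxAr.
have -> : K *m D *m A^T *m (A *m (D^T *m K)) = sqnorm A *: (K *m D *m (D^T *m K)).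
  rewrite mulmxA -[K *m D *m A^T *m A]mulmxA sc_sqnorm mul_mx_scalar.
  by rewrite scalemxAl.
have -> : X^T *m W^T *m (W *m X) = H by rewrite !mulmxA.
rewrite /s q2.
move: (K *m D *m F^T) (F *m (D^T *m K)) (K *m D *m (D^T *m K)) => KDF FDK KDDK.
apply/matrixP => i j; rewrite !mxE; field.
by rewrite q0 n0R.
Qed.

Lemma gd_step_sqnorm :
  sqnorm A - 4 * eta / n%:R * sc (F^T *m D) <= sqnorm A'.
Proof.
rewrite /A' /gd_step/= -DE -/q -/s sqnormBZ AWXD sc_scalar.
have -> : 2 * s * (q * sc (F^T *m D)) = 4 * eta / n%:R * sc (F^T *m D).
  by rewrite /s; field; rewrite q0 n0R.
by rewrite lerDl mulr_ge0 ?sqr_ge0 ?sqnorm_ge0.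
Qed.

End GradientStep.

(** * Orthonormal frames and the projection onto their span *)

Section OrthonormalFrame.
Variables (R : realType) (d n r : nat) (V : 'M[R]_(n, r)).
Hypothesis VtV : V^T *m V = 1%:M.

Lemma sqnorm_frame (y : 'cV[R]_r) : sqnorm (V *m y) = sqnorm y.
Proof.
rewrite -[LHS]sc_scalar -sc_sqnorm trmx_mul -mulmxA [V^T *m _]mulmxA VtV mul1mx.
by rewrite sc_sqnorm sc_scalar.
Qed.

(** Bessel's inequality, from the nonnegative squared distance of [u] to its projection. *)
Lemma sqnorm_trframe_le (u : 'cV[R]_n) : sqnorm (V^T *m u) <= sqnorm u.
Proof.
have := sqnorm_ge0 _ _ (u - 1 *: (V *m (V^T *m u))).
rewrite sqnormBZ sqnorm_frame mulmxA.
have -> : u^T *m V *m (V^T *m u) = (sqnorm (V^T *m u))%:M.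
  by rewrite -sc_sqnorm trmx_mul trmxK.
rewrite sc_scalar; lra.
Qed.

Lemma mulmx_tr_eq0 (B : 'M[R]_(d, n)) : B^T *m B = 0 -> B = 0.
Proof.
move=> /matrixP B0; apply/matrixP => k j; rewrite mxE.
have := B0 j j; rewrite !mxE => /eqP; under eq_bigr do rewrite mxE -expr2.
rewrite psumr_eq0; last by move=> l _; exact: sqr_ge0.
by move=> /allP/(_ k (mem_index_enum _)); rewrite sqrf_eq0 => /eqP.
Qed.

(** The defect [Z = X - X *m V *m V^T] satisfies [Z^T *m Z = 0], hence vanishes. *)
Lemma frame_row_space (X : 'M[R]_(d, n)) (L : 'M[R]_r) :
  X^T *m X = V *m L *m V^T -> V *m (V^T *m X^T) = X^T.
Proof.
move=> XX.
have KP : X^T *m X *m V *m V^T = X^T *m X.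
  by rewrite XX -[_ *m V^T *m V]mulmxA VtV mulmx1.
have /mulmx_tr_eq0 Z0 : (X - X *m V *m V^T)^T *m (X - X *m V *m V^T) = 0.
  rewrite [(_ - _)^T]linearB/= !trmx_mul trmxK mulmxBr !mulmxBl !mulmxA KP.
  have -> : V *m V^T *m X^T *m X = X^T *m X.
    by rewrite -!mulmxA XX !mulmxA -[_ *m V^T *m V]mulmxA VtV mulmx1.
  by rewrite KP subrr.
have /eqP : X - X *m V *m V^T = 0 by [].
by rewrite subr_eq0 => /eqP {2}->; rewrite !trmx_mul trmxK.
Qed.

End OrthonormalFrame.

Lemma sc_col_mulmx (R : realType) n r (V : 'M[R]_(n, r)) (S : 'M[R]_n) i j :
  sc ((col i V)^T *m S *m col j V) = (V^T *m S *m V) i j.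
Proof.
rewrite tr_col -row_mul /sc !mxE; apply: eq_bigr => l _.
by rewrite [in LHS]mxE [X in _ * X]mxE.
Qed.

Section EigenCoordinates.
Variables (R : realType) (d n m r : nat) (eta : R).
Variables (X : 'M[R]_(d, n)) (Y : 'cV[R]_n).
Variables (A0 : 'cV[R]_m) (W0 : 'M[R]_(m, d)).
Variables (lam : nat -> R) (V : 'M[R]_(n, r.+1)).
Hypotheses (n0 : (0 < n)%N) (m0 : (0 < m)%N).
Hypothesis VtV : V^T *m V = 1%:M.
Let L : 'M[R]_r.+1 := diag_mx (\row_i lam i).
Hypothesis KE : X^T *m X = V *m L *m V^T.
Hypothesis VY : V *m (V^T *m Y) = Y.

Let K := X^T *m X.
Let H t := X^T *m (Wt eta X Y A0 W0 t)^T *m Wt eta X Y A0 W0 t *m X.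
Let F t := Ft eta X Y A0 W0 t.
Let D t := Dt eta X Y A0 W0 t.

Definition target (i : 'I_r.+1) : R := (V^T *m Y) i 0.
(** The sign makes [resid] start at [target] when the initial output is zero. *)
Definition resid (t : nat) (i : 'I_r.+1) : R := - (V^T *m D t) i 0.
Definition gcoord (t : nat) (i j : 'I_r.+1) : R :=
  (V^T *m Gammat eta X Y A0 W0 t *m V) i j.
Definition asq (t : nat) : R := sqnorm (At eta X Y A0 W0 t).
Let md : R := m%:R / d%:R.
Let gn := gain _ _ eta n%:R m%:R md target resid asq.
Let ov := overlap _ _ target resid.

Let n0R : n%:R != 0 :> R.
Proof. by rewrite pnatr_eq0 -lt0n. Qed.

Let m0R : m%:R != 0 :> R.
Proof. by rewrite pnatr_eq0 -lt0n. Qed.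

Lemma trajS t : (At eta X Y A0 W0 t.+1, Wt eta X Y A0 W0 t.+1) =
  gd_step eta X Y (At eta X Y A0 W0 t, Wt eta X Y A0 W0 t).
Proof. by rewrite /At /Wt /traj iterS -!surjective_pairing. Qed.

Lemma AtS t : At eta X Y A0 W0 t.+1 =
  (gd_step eta X Y (At eta X Y A0 W0 t, Wt eta X Y A0 W0 t)).1.
Proof. by rewrite -trajS. Qed.

Lemma WtS t : Wt eta X Y A0 W0 t.+1 =
  (gd_step eta X Y (At eta X Y A0 W0 t, Wt eta X Y A0 W0 t)).2.
Proof. by rewrite -trajS. Qed.

Let PX : V *m (V^T *m X^T) = X^T.
Proof. exact: (frame_row_space _ _ _ _ _ VtV _ _ KE). Qed.

Let PF t : V *m (V^T *m F t) = F t.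
Proof.
rewrite /F /Ft /outF -!scalemxAr; congr (_ *: _).
by rewrite !mulmxA -[V *m V^T *m X^T]mulmxA PX.
Qed.

Let PD t : V *m (V^T *m D t) = D t.
Proof.
have -> : D t = F t - Y by [].
by rewrite !mulmxBr PF VY.
Qed.

Let VtK : V^T *m K = L *m V^T.
Proof. by rewrite /K KE !mulmxA VtV mul1mx. Qed.

Lemma frame_gram i j : (V^T *m K *m V) i j = if i == j then lam i else 0.
Proof.
rewrite VtK -mulmxA VtV mulmx1 /L !mxE; case: eqP => _; by rewrite ?mulr1n ?mulr0n.
Qed.

Let VtKD t i : (V^T *m (K *m D t)) i 0 = - (lam i * resid t i).
Proof.
by rewrite mulmxA VtK -mulmxA mul_diag_mx mxE mxE /resid mulrN opprK.
Qed.

Let VtF t i : (V^T *m F t) i 0 = target i - resid t i.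
Proof.
rewrite /resid opprK /target.
have -> : D t = F t - Y by [].
by rewrite mulmxBr [X in _ + X]mxE [X in _ + (_ + X)]mxE addrC subrK.
Qed.

Lemma overlapE t : ov t = - sc ((F t)^T *m D t).
Proof.
rewrite -[D t]PD mulmxA.
have -> : (F t)^T *m V = (V^T *m F t)^T by rewrite trmx_mul trmxK.
rewrite /sc mxE -sumrN /ov /overlap; apply: eq_bigr => i _.
by rewrite mxE VtF /resid mulrN.
Qed.

Let tr_sc (a : 'M[R]_1) : sc a^T = sc a.
Proof. by rewrite /sc mxE. Qed.

(** Moving [md *: K] out of the Gram term leaves a part diagonal in the frame plus the perturbation
    Gamma. *)
Lemma Mstar_split t :
  Mstar eta X Y A0 W0 t = gn t *: K + Gammat eta X Y A0 W0 t.
Proof.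
have -> : gn t = 2 / (m%:R * n%:R) *
    (asq t + md - 2 * eta / n%:R * sc ((F t)^T *m D t)).
  by rewrite /gn /gain -/(ov t) overlapE mulrN.
rewrite /Mstar /Mt /Gammat -/(F t) -/(D t) -/(H t) -/K -/(asq t) -/md.
rewrite -[(D t)^T *m F t]trmxK tr_sc trmx_mul trmxK.
move: (H t) K (sc _) md => h k s e.
by apply/matrixP => i j; rewrite !mxE; field; rewrite n0R m0R.
Qed.

Lemma Mt_split t : Mt eta X Y A0 W0 t =
  2 / (m%:R * n%:R) * (asq t + md) *: K + Gammat eta X Y A0 W0 t.
Proof.
rewrite /Mt /Gammat -/(H t) -/K -/(asq t) -/md.
move: (H t) K md => h k e.
by apply/matrixP => i j; rewrite !mxE; field; rewrite n0R m0R.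
Qed.

Lemma residS t i : resid t.+1 i = resid t i -
  eta * (gn t * lam i * resid t i + \sum_j gcoord t i j * resid t j).
Proof.
have step : D t.+1 = D t - eta *: (Mstar eta X Y A0 W0 t *m D t).
  rewrite {1}/D /Dt /resD AtS WtS.
  rewrite (gd_step_outF _ _ _ _ _ _ _ _ _ (F t) (D t) n0 m0)//.
  rewrite /Mstar /Mt mulmxBl -!scalemxAl mulmxDl -scalemxAl.
  rewrite -[(D t)^T *m Ft _ _ _ _ _ _]trmxK tr_sc trmx_mul trmxK -/(F t).
  have -> : D t = F t - Y by [].
  rewrite -/K -/(H t); move: (F t) (K *m _) (H t *m _) (sc _) => f k h s.
  by apply/matrixP => a b; rewrite !mxE; field; rewrite n0R m0R.
have GD : \sum_j gcoord t i j * resid t j =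
    - (V^T *m (Gammat eta X Y A0 W0 t *m D t)) i 0.
  rewrite -[in RHS](PD t) !mulmxA -[_ *m D t]mulmxA mxE -sumrN.
  by apply: eq_bigr => j _; rewrite /resid mulrN.
have e : (V^T *m D t.+1) i 0 = (V^T *m D t) i 0 - eta *
    (gn t * (V^T *m (K *m D t)) i 0
     + (V^T *m (Gammat eta X Y A0 W0 t *m D t)) i 0).
  rewrite step Mstar_split; move: (D t) => e.
  rewrite mulmxBr -scalemxAr mulmxDl mulmxDr -scalemxAl -scalemxAr.
  move: (V^T *m e) (V^T *m (K *m e)) (V^T *m (_ *m e)) => a b c.
  by rewrite !mxE.
by rewrite GD {1}/resid e VtKD /resid; ring.
Qed.

(** Only the Gram term of Gamma moves, by outer products of [K *m D] and [F]; in coordinates these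
    become products of [- lam * resid] and [target - resid]. *)
Lemma gcoordS t i j : gcoord t.+1 i j = gcoord t i j +
  2 / (m%:R * n%:R) * (2 * eta / n%:R *
     (lam i * resid t i * (target j - resid t j) +
      (target i - resid t i) * (lam j * resid t j))
    + 4 * eta ^+ 2 / (n%:R ^+ 2 * m%:R) * asq t *
      (lam i * resid t i * (lam j * resid t j))).
Proof.
have outer (a b : 'cV[R]_n) : (V^T *m (a *m b^T) *m V) i j =
    (V^T *m a) i 0 * (V^T *m b) j 0.
  have -> : V^T *m (a *m b^T) *m V = (V^T *m a) *m (V^T *m b)^T.
    by rewrite trmx_mul trmxK !mulmxA.
  by rewrite mxE big_ord1 [X in _ * X]mxE.
have step : Gammat eta X Y A0 W0 t.+1 = Gammat eta X Y A0 W0 t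
  + 2 / (m%:R * n%:R) *: (- (2 * eta / n%:R) *:
      (K *m D t *m (F t)^T + F t *m (K *m D t)^T)
    + (4 * eta ^+ 2 / (n%:R ^+ 2 * m%:R) * asq t) *: (K *m D t *m (K *m D t)^T)).
  rewrite /Gammat -/(H t) {1}WtS.
  rewrite (gd_step_gram _ _ _ _ _ _ _ _ _ (F t) (D t) n0 m0)// -/K -/(H t) -/(asq t).
  move: (H t) K (K *m D t *m (F t)^T) (F t *m (K *m D t)^T)
    (K *m D t *m (K *m D t)^T) => h k a b c.
  by apply/matrixP => u w; rewrite !mxE; ring.
have ea := outer (K *m D t) (F t); have eb := outer (F t) (K *m D t).
have ec := outer (K *m D t) (K *m D t).
rewrite /gcoord step; move: ea eb ec; rewrite !VtKD !VtF.
move: (Gammat _ _ _ _ _ _) (K *m D t *m (F t)^T) (F t *m (K *m D t)^T)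
  (K *m D t *m (K *m D t)^T) => g a b c.
rewrite !(mulmxDl, mulmxDr) -!(scalemxAl, scalemxAr) !(mulmxDl, mulmxDr).
rewrite -!(scalemxAl, scalemxAr) !(mulmxDl, mulmxDr).
move: (V^T *m g *m V) (V^T *m a *m V) (V^T *m b *m V) (V^T *m c *m V) => g' a' b' c'.
by move=> ea eb ec; rewrite !mxE ea eb ec; ring.
Qed.

Lemma asqS t : asq t + 4 * eta / n%:R * ov t <= asq t.+1.
Proof.
rewrite {2}/asq AtS overlapE mulrN.
exact: (gd_step_sqnorm _ _ _ _ _ _ _ _ _ _ _ n0 m0).
Qed.

Lemma nrm_resid t : nrm (resid t) ^+ 2 = sqnorm (D t).
Proof.
rewrite nrm_sqr -[in RHS](PD t) sqnorm_frame//.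
by apply: eq_bigr => i _; rewrite /resid sqrrN.
Qed.

Lemma nrm_target : nrm target ^+ 2 = sqnorm Y.
Proof. by rewrite nrm_sqr -[in RHS]VY sqnorm_frame. Qed.

Lemma tr_Mstar t : (Mstar eta X Y A0 W0 t)^T = Mstar eta X Y A0 W0 t.
Proof.
have KT : K^T = K by rewrite /K trmx_mul trmxK.
have HT : (H t)^T = H t by rewrite /H !trmx_mul !trmxK !mulmxA.
rewrite Mstar_split [LHS]linearD/= [(gn t *: K)^T]linearZ/= KT; congr (_ + _).
rewrite /Gammat -/(H t) -/K [LHS]linearZ/= [(_ - _)^T]linearB/= HT.
by rewrite [(_ *: K)^T]linearZ/= KT.
Qed.

(** The Rayleigh quotient of [Mstar] at the first frame vector converts the spectral stopping rule
    into the scalar clause of [running]. *)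
Lemma gain_le mu t : (forall a, eigenvalue (Mstar eta X Y A0 W0 t) a -> a <= mu) ->
  gn t * lam 0%N + gcoord t ord0 ord0 <= mu.
Proof.
move=> hmu.
have := rayleigh_le_eigenvalue_bound _ _ _ mu (tr_Mstar t) hmu
  (col ord0 V).
have -> : sqnorm (col ord0 V) = 1.
  transitivity ((V^T *m V) ord0 ord0); last by rewrite VtV mxE.
  by rewrite mxE; apply: eq_bigr => i _; rewrite !mxE expr2.
rewrite /qform sc_col_mulmx.
rewrite mulr1 Mstar_split mulmxDr mulmxDl -scalemxAr -scalemxAl.
by rewrite mxE [X in X + _]mxE frame_gram eqxx.
Qed.

Lemma Mt_frame00 t : (V^T *m Mt eta X Y A0 W0 t *m V) ord0 ord0 =
  2 / (m%:R * n%:R) * (asq t + md) * lam 0%N + gcoord t ord0 ord0.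
Proof.
rewrite Mt_split mulmxDr mulmxDl -scalemxAr -scalemxAl.
by rewrite mxE [X in X + _]mxE frame_gram eqxx.
Qed.

Lemma opnorm_Gammat_le t (c : R) : 0 <= c ->
  (forall u : 'I_r.+1 -> R,
     nrm (fun i => \sum_j gcoord t i j * u j) <= c * nrm u) ->
  opnorm (Gammat eta X Y A0 W0 t) <= c.
Proof.
move=> c0 hc.
(* Gamma has the form [X^T *m M *m X], so the frame projection fixes it on both sides and its
   coordinates carry its whole norm. *)
have GE : Gammat eta X Y A0 W0 t =
    V *m (V^T *m Gammat eta X Y A0 W0 t *m V) *m V^T.
  have PGP M : V *m (V^T *m (X^T *m M *m X) *m V) *m V^T = X^T *m M *m X.
    have PX' : X *m V *m V^T = X.
      by rewrite -[RHS]trmxK -PX !trmx_mul !trmxK.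
    by rewrite !mulmxA -[V *m V^T *m X^T]mulmxA PX -!mulmxA [X *m (V *m _)]mulmxA PX'.
  have -> : Gammat eta X Y A0 W0 t = X^T *m ((2 / (m%:R * n%:R)) *:
      ((Wt eta X Y A0 W0 t)^T *m Wt eta X Y A0 W0 t - md%:M)) *m X.
    rewrite /Gammat -scalemxAr -scalemxAl mulmxBr mulmxBl !mulmxA; congr (_ *: (_ - _)).
    by rewrite mul_mx_scalar scalemxAl.
  by rewrite PGP.
apply: sup_le_ub.
  exists (enorm (Gammat eta X Y A0 W0 t *m 0)), 0 => //=.
  by rewrite /enorm /sqnorm big1 ?sqrtr0// => i _; rewrite mxE expr0n.
move=> _ [u /= u1 <-].
have -> : enorm (Gammat eta X Y A0 W0 t *m u) =
    nrm (fun i => \sum_j gcoord t i j * (V^T *m u) j 0).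
  rewrite /enorm GE -!mulmxA sqnorm_frame//; congr Num.sqrt.
  apply: eq_bigr => i _; rewrite !mulmxA -[_ *m V^T *m u]mulmxA mxE.
  by [].
apply: (le_trans (hc _)); rewrite ler_piMr//.
apply: le_trans u1; rewrite /enorm /nrm.
by rewrite ler_wsqrtr//; exact: sqnorm_trframe_le.
Qed.

End EigenCoordinates.

(** * Numerical constants and the final assembly *)

Lemma width_bounds (R : realType) (c1 sigma n N m lr kappa eps : R) :
  0 < c1 -> 0 < sigma -> sigma <= 1 -> 0 < N -> N ^+ 2 = n -> 0 < m -> 0 < lr ->
  0 < kappa -> kappa <= 1 -> 0 < eps -> lr <= c1 * n ->
  (320 * c1 + 1921 / sigma) * (n ^+ 2 / lr ^+ 2) <= m ->
  lr / kappa ^+ 2 <= n -> lr ^+ 2 / (kappa ^+ 4 * eps ^+ 2) <= n ->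
  let c := 160 * n / (m * lr) in
  [/\ 2 * c <= 1, 6 * (c * N) < kappa * eps
    & 12 * (c * N) < kappa ^+ 2 * N * sigma].
Proof.
move=> c10 s0 s1 N0 NN m0 lr0 k0 k1 e0 lrn mC n1 n2 c.
have n0 : 0 < n by rewrite -NN exprn_gt0.
have cpos : 0 < c by rewrite /c divr_gt0// mulr_gt0.
have nl : 0 < n ^+ 2 / lr by rewrite divr_gt0// exprn_gt0.
have mlr : (320 * c1 + 1921 / sigma) * (n ^+ 2 / lr) <= m * lr.
  have := ler_wpM2r (ltW lr0) mC.
  rewrite (_ : (320 * c1 + 1921 / sigma) * (n ^+ 2 / lr ^+ 2) * lr =
    (320 * c1 + 1921 / sigma) * (n ^+ 2 / lr))//.
  by field; rewrite !gt_eqF.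
have lrn2 : lr <= kappa ^+ 2 * n by move: n1; rewrite ler_pdivrMr ?exprn_gt0// mulrC.
have lrk : lr <= kappa ^+ 2 * eps * N.
  have p0 : 0 <= kappa ^+ 2 * eps * N by rewrite !mulr_ge0 ?exprn_ge0 ?ltW.
  rewrite -ler_sqr ?nnegrE ?(ltW lr0)//.
  move: n2; rewrite ler_pdivrMr ?mulr_gt0 ?exprn_gt0// => h.
  by rewrite (le_trans h)// -NN le_eqVlt; apply/orP; left; apply/eqP; ring.
(* The summand [320 * c1] serves here: [lr <= c1 * n] gives [n <= c1 * (n ^+ 2 / lr)]. *)
have h1 : 320 * n <= m * lr.
  apply: le_trans mlr; apply: (@le_trans _ _ (320 * c1 * (n ^+ 2 / lr))).
    have : lr * (n / lr) <= c1 * n * (n / lr) by rewrite ler_wpM2r// divr_ge0// ltW.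
    rewrite (_ : lr * (n / lr) = n); last by field; rewrite gt_eqF.
    rewrite (_ : c1 * n * (n / lr) = c1 * (n ^+ 2 / lr)); last by ring.
    lra.
  by rewrite ler_wpM2r ?(ltW nl)// lerDl divr_ge0// ltW.
have h2 : 1921 * (n ^+ 2 / lr) <= sigma * (m * lr).
  have := ler_wpM2l (ltW s0) mlr.
  have -> : sigma * ((320 * c1 + 1921 / sigma) * (n ^+ 2 / lr)) =
    sigma * (320 * c1) * (n ^+ 2 / lr) + 1921 * (n ^+ 2 / lr).
    by field; rewrite !gt_eqF.
  have : 0 <= sigma * (320 * c1) * (n ^+ 2 / lr).
    by rewrite !mulr_ge0// ?(ltW s0) ?(ltW c10)// ?invr_ge0 ?exprn_ge0 ?(ltW n0) ?(ltW lr0).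
  lra.
(* As [12 * 160 = 1920], the constant 1921 leaves room for the strict inequalities below. *)
have h3 : 1921 * (c * n) <= 160 * sigma * lr.
  have cl : 0 <= c * lr / n by rewrite ltW// divr_gt0// mulr_gt0.
  have := ler_wpM2l cl h2.
  rewrite (_ : c * lr / n * (1921 * (n ^+ 2 / lr)) = 1921 * (c * n)); last first.
    by field; rewrite !gt_eqF.
  rewrite (_ : c * lr / n * (sigma * (m * lr)) = 160 * sigma * lr)//.
  by rewrite /c; field; rewrite !gt_eqF.
split.
- by rewrite /c mulrA ler_pdivrMr ?mulr_gt0//; lra.
- rewrite -(ltr_pM2r N0).
  have a1 : sigma * lr <= 1 * lr by rewrite ler_wpM2r// ltW.
  have a2 : kappa * (kappa * eps * N) <= 1 * (kappa * eps * N).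
    by rewrite ler_wpM2r// !mulr_ge0// ltW.
  have a3 : 0 < kappa * eps * N by rewrite !mulr_gt0.
  have -> : 6 * (c * N) * N = 6 * (c * n) by rewrite -NN; ring.
  lra.
- rewrite -(ltr_pM2r N0).
  have a1 : sigma * lr <= sigma * (kappa ^+ 2 * n) by rewrite ler_wpM2l// ltW.
  have a3 : 0 < sigma * (kappa ^+ 2 * n) by rewrite !mulr_gt0// exprn_gt0.
  have -> : 12 * (c * N) * N = 12 * (c * n) by rewrite -NN; ring.
  have -> : kappa ^+ 2 * N * sigma * N = sigma * (kappa ^+ 2 * n) by rewrite -NN; ring.
  lra.
Qed.

Theorem theorem4p1 (R : realType) (chi c1 eta : R) :
  1 < chi -> 0 < c1 -> 0 < eta -> eta * c1 < 1 ->
  exists C1 C2 C3 : R, [/\ 0 < C1, 0 < C2 & 0 < C3] /\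
  forall (eps : R), 0 < eps ->
  forall (d n h : nat) (X : 'M[R]_(d, n)) (Y : 'cV[R]_n)
         (a0 : 'cV[R]_h) (w0 : 'M[R]_(h, d))
         (r : nat) (lam : nat -> R) (v : nat -> 'cV[R]_n) (kappa : R),
  let m := (h + h)%N in
  let A0 : 'cV[R]_m := col_mx a0 (- a0) in
  let W0 : 'M[R]_(m, d) := col_mx w0 w0 in
  (* dimensions *)
  (0 < d)%N -> (0 < n)%N ->
  (* labels in {-1,1} *)
  (forall i, Y i 0 = 1 \/ Y i 0 = -1) ->
  (* realizability: Y^T = A*^T W* X *)
  (exists (As : 'cV[R]_m) (Ws : 'M[R]_(m, d)), Y^T = As^T *m Ws *m X) ->
  (* symmetric initialization *)
  (forall q, a0 q 0 = 1 \/ a0 q 0 = -1) ->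
  w0^T *m w0 = (m%:R / (2 * d%:R)) *: 1%:M ->
  (* eigendecomposition of X^T X (0-indexed: lam 0 = lambda_1) *)
  (0 < r)%N ->
  (forall i j, (i < r)%N -> (j < r)%N -> (v i)^T *m v j = ((i == j)%:R)%:M) ->
  X^T *m X = \sum_(i < r) lam i *: (v i *m (v i)^T) ->
  (forall i, (i.+1 < r)%N -> lam i.+1 <= lam i) ->
  0 < lam r.-1 ->
  (* (A1) *)
  (forall i, (i.+1 < r)%N -> lam i <= chi * lam i.+1) ->
  ((1 < r)%N -> 2 * lam 1%N <= lam 0%N) ->
  (* (A2) *)
  0 < kappa ->
  (forall i, (i < r)%N -> kappa <= sc (Y^T *m v i) / Num.sqrt (n%:R)) ->
  (* lambda_1 = c1 n *)
  lam 0%N = c1 * n%:R ->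
  (* width and sample-size conditions *)
  C1 * (n%:R ^+ 2 / lam r.-1 ^+ 2) <= m%:R ->
  C2 * Num.max (Num.max (lam r.-1 / kappa ^+ 2) (lam r.-1 ^+ 2 / kappa ^+ 2))
               (Num.max (lam r.-1 ^+ 2 / (kappa ^+ 4 * eps ^+ 2))
                        (lam r.-1 ^+ 4 / (kappa ^+ 4 * eps ^+ 2)))
    <= n%:R ->
  let stop (t : nat) :=
    sqnorm (Dt eta X Y A0 W0 t) <= C3 * eps ^+ 2 \/
    exists a, eigenvalue (Mstar eta X Y A0 W0 t) a /\ eta^-1 < a in
  let Lam (t : nat) := sc ((v 0%N)^T *m Mt eta X Y A0 W0 t *m v 0%N) in
  forall t : nat, (1 <= t)%N -> (forall s, (s <= t)%N -> ~ stop s) ->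
    0 < Lam t.+1 - Lam t /\
    opnorm (Gammat eta X Y A0 W0 t) <= 40 / m%:R.
Proof.
move=> chi1 c10 eta0 ec1.
(* [eta * c1] is the progress of the top mode after one step; [1 / (2 * chi)] is what remains of 1/2
   after passing to the next eigenvalue. *)
pose sigma := Num.min (eta * c1) (2 * chi)^-1.
have chi0 : 0 < chi by exact: lt_trans chi1.
have s0 : 0 < sigma by rewrite lt_min mulr_gt0//= invr_gt0 mulr_gt0.
have sec : sigma <= eta * c1 by rewrite ge_min lexx.
have s1 : sigma <= 1 by rewrite (le_trans sec)// ltW.
have schi : sigma * (2 * chi) <= 1.
  by rewrite -ler_pdivlMr ?mulr_gt0// mul1r ge_min lexx orbT.
have C10 : 0 < 320 * c1 + 1921 / sigma by rewrite addr_gt0 ?mulr_gt0 ?invr_gt0.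
(* The value 4 makes non-stopping mean that the residual norm exceeds [2 * eps]. *)
exists (320 * c1 + 1921 / sigma), 1, 4; split; first by split.
move=> eps eps0 d n h X Y a0 w0 [|r] lam v kappa m A0 W0 d0 n0 Yl [As [Ws YE]]
  a0l w0E // _ vo KE lamdec lamr0 lamchi _ k0 kz lam0 mC nC stop Lam t t1 nst.
rewrite [r.+1.-1]/= in lamr0 mC nC.
have n0R : 0 < n%:R :> R by rewrite ltr0n.
have lamW (i : nat) : (i <= r)%N -> lam r <= lam i <= lam 0%N.
  have dec : forall j k, (k + j <= r)%N -> lam (k + j)%N <= lam k.
    elim=> [|j IH] k; first by rewrite addn0.
    by rewrite addnS => kj; rewrite (le_trans (lamdec _ _))// IH// ltnW.
  move=> ir; apply/andP; split; first by rewrite -{1}(subnKC ir) dec// subnKC.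
  by have := dec i 0%N; rewrite add0n; exact.
have m0R : 0 < m%:R :> R.
  by apply: lt_le_trans mC; rewrite mulr_gt0 ?divr_gt0 ?exprn_gt0.
have m0 : (0 < m)%N by rewrite -(ltr0n R).
pose V := \matrix_(j < n, i < r.+1) v i j 0.
have VtV : V^T *m V = 1%:M.
  apply/matrixP => i j; rewrite !mxE.
  have /matrixP/(_ 0 0) := vo i j (ltn_ord i) (ltn_ord j).
  rewrite !mxE eqxx mulr1n => <-; apply: eq_bigr => k _; by rewrite !mxE.
have XX : X^T *m X = V *m diag_mx (\row_i lam i) *m V^T.
  rewrite KE; apply/matrixP => i j; rewrite summxE mxE; apply: eq_bigr => k _.
  by rewrite mul_mx_diag !mxE big_ord1 !mxE; ring.
have PX := frame_row_space _ _ _ _ _ VtV _ _ XX.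
(* Realizability puts [Y] in the range of [X^T], which the projection fixes. *)
have VY : V *m (V^T *m Y) = Y.
  have -> : Y = X^T *m (Ws^T *m As).
    by rewrite -[LHS]trmxK YE !trmx_mul trmxK.
  by rewrite mulmxA [in LHS]mulmxA -[V *m V^T *m X^T]mulmxA PX.
pose N : R := Num.sqrt n%:R.
have NN : N ^+ 2 = n%:R by rewrite sqr_sqrtr.
have N0 : 0 < N by rewrite sqrtr_gt0.
have zN : nrm (target _ _ _ Y V) = N.
  rewrite /nrm -nrm_sqr (nrm_target _ _ _ _ _ VtV VY); congr Num.sqrt.
  rewrite /sqnorm (eq_bigr (fun=> 1)) ?sumr_const ?card_ord// => i _.
  by case: (Yl i) => ->; rewrite ?sqrrN expr1n.
have vcol (i : 'I_r.+1) : v i = col i V.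
  by apply/matrixP => j k; rewrite !mxE (ord1 k).
have kz' i : kappa * N <= target _ _ _ Y V i.
  have := kz i (ltn_ord i); rewrite ler_pdivlMr// => /le_trans; apply.
  rewrite le_eqVlt; apply/orP; left; apply/eqP.
  rewrite /target /sc !mxE; apply: eq_bigr => j _; rewrite !mxE; ring.
have k1 : kappa <= 1.
  rewrite -(ler_pM2r N0) mul1r -{2}zN (le_trans (kz' ord0))//.
  exact: le_trans (ler_norm _) (le_nrm _ _ _ _).
move: nC; rewrite mul1r !ge_max => /andP[/andP[nC1 _] /andP[nC2 _]].
have lrn : lam r <= c1 * n%:R by rewrite -lam0; have /andP[] := lamW r (leqnn r).
have [cN ce cs] := width_bounds _ _ _ _ _ _ _ _ _ c10 s0 s1 N0 NN m0R lamr0 k0 k1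
  eps0 lrn mC nC1 nC2.
pose x := resid _ _ _ _ _ eta X Y A0 W0 V.
pose G := gcoord _ _ _ _ _ eta X Y A0 W0 V.
pose al := asq _ _ _ _ eta X Y A0 W0.
pose z := target _ _ _ Y V.
pose md : R := m%:R / d%:R.
have md0 : 0 <= md by rewrite divr_ge0.
have F0 : Ft eta X Y A0 W0 0 = 0.
  rewrite /Ft /outF /At /Wt /traj/= -mulmxA tr_col_mx mul_row_col mulmxN subrr.
  by rewrite mulmx0 scaler0.
have x0E i : x 0%N i = z i.
  rewrite /x /resid /z /target /Dt /resD -/(Ft eta X Y A0 W0 0) F0 sub0r mulmxN.
  by rewrite mxE opprK.
have G0E i j : G 0%N i j = 0.
  rewrite /G /gcoord.
  have -> : Gammat eta X Y A0 W0 0 = 0; last by rewrite mulmx0 mul0mx mxE.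
  have WW : W0^T *m W0 = md *: 1%:M.
    rewrite tr_col_mx mul_row_col w0E -scalerDl /md; congr (_ *: _).
    by field; rewrite pnatr_eq0 -lt0n.
  rewrite /Gammat /Wt /traj/= -[X^T *m _ *m _]mulmxA WW -scalemxAr mulmx1.
  by rewrite -scalemxAl subrr scaler0.
have al0E : al 0%N = m%:R.
  rewrite /al /asq /At /traj/= /sqnorm (eq_bigr (fun=> 1)) ?sumr_const ?card_ord//.
  move=> i _; rewrite mxE; case: splitP => j _; rewrite ?mxE;
    by case: (a0l j) => ->; rewrite ?opprK ?sqrrN expr1n.
have xS := residS _ _ _ _ _ eta X Y A0 W0 lam V n0 m0 VtV XX VY.
have GS := gcoordS _ _ _ _ _ eta X Y A0 W0 lam V n0 m0 VtV XX.
have alS := asqS _ _ _ _ _ eta X Y A0 W0 lam V n0 m0 VtV XX VY.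
have run s : (s <= t)%N ->
    running _ _ eta eps n%:R m%:R md lam z x G al s.
  move=> st; have /not_orP[/negP + noeig] := nst s st.
  rewrite -ltNge => D0; split.
    rewrite -ltr_sqr ?nnegrE ?nrm_ge0 ?mulr_ge0 ?(ltW eps0)//.
    rewrite (nrm_resid _ _ _ _ _ _ _ _ _ _ _ _ VtV XX VY).
    by rewrite exprMn (_ : 2 ^+ 2 = 4)//; ring.
  have hg := gain_le _ _ _ _ _ eta X Y A0 W0 lam V n0 m0 VtV XX VY eta^-1 s.
  have {}hg : gain _ _ eta n%:R m%:R md z x al s * lam 0%N + G s ord0 ord0 <= eta^-1.
    apply: hg => a ea.
    by rewrite leNgt; apply/negP => ha; apply: noeig; exists a.
  have := ler_wpM2l (ltW eta0) hg; rewrite mulfV ?gt_eqF//.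
  by rewrite mulrDr mulrA.
have [opG pos] := running_bounds _ _ _ _ _ _ _ _ _ _ _ _ _ _ _ _ _
  eta0 chi1 c10 ec1 k0 eps0 n0R N0 m0R NN md0 s0 sec schi lam0 lamr0 lamW lamchi
  zN kz' cN ce cs x0E xS G0E GS al0E alS t t1 run.
split; last first.
  apply: (@le_trans _ _ (36 / m%:R)); last by rewrite ler_pM2r ?invr_gt0// ler_nat.
  apply: (opnorm_Gammat_le _ _ _ _ _ _ _ _ _ _ _ _ VtV XX) => //.
  by rewrite divr_ge0.
have LamE s : Lam s = 2 / (m%:R * n%:R) * (al s + md) * lam 0%N + G s ord0 ord0.
  rewrite /Lam (vcol ord0) sc_col_mulmx.
  exact: (Mt_frame00 _ _ _ _ _ _ _ _ _ _ _ _ n0 m0 VtV XX).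
(* The growth of [al] contributes the whole overlap and the growth of [G 0 0] the top mode once
   more, so that mode has weight 2. The second-order part of the growth of [G 0 0] is
   nonnegative. *)
pose w (i : 'I_r.+1) : R := 1 + (i == ord0)%:R.
have w12 i : 1 <= w i <= 2 by rewrite /w; case: eqP => _ /=; lra.
have wE : \sum_i w i * ((z i - x t i) * x t i) =
    overlap _ _ z x t + (z ord0 - x t ord0) * x t ord0.
  under eq_bigr do rewrite /w mulrDl mul1r.
  rewrite big_split/=; congr (_ + _).
  rewrite (bigD1 ord0)//= mul1r big1 ?addr0// => i /negbTE ->.
  by rewrite mul0r.
have := pos w w12; rewrite wE => ov0.
rewrite !LamE [G t.+1 _ _]GS -/z -/x -/G -/al.
set a := (z ord0 - _) * _ in ov0 *.
have l0 : 0 < lam 0%N by rewrite lam0 mulr_gt0.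
have mn0 : 0 < 2 / (m%:R * n%:R) * lam 0%N :> R by rewrite mulr_gt0// divr_gt0// mulr_gt0.
have := ler_wpM2l (ltW mn0) (alS t).
have : 0 < 2 / (m%:R * n%:R) * lam 0%N * (4 * eta / n%:R * (overlap _ _ z x t + a)).
  by rewrite mulr_gt0// mulr_gt0// divr_gt0// mulr_gt0.
have : 0 <= 2 / (m%:R * n%:R) * (4 * eta ^+ 2 / (n%:R ^+ 2 * m%:R) * al t *
     (lam 0%N * x t ord0 * (lam 0%N * x t ord0))).
  have al0 : 0 <= al t by exact: sqnorm_ge0.
  apply: mulr_ge0; first by rewrite divr_ge0// mulr_ge0.
  apply: mulr_ge0; last by rewrite -expr2 sqr_ge0.
  apply: mulr_ge0 => //; apply: divr_ge0; first by rewrite mulr_ge0 ?sqr_ge0.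
  by rewrite mulr_ge0 ?sqr_ge0.
rewrite -/al /a; lra.
Qed.
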